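(* Assume the following three conditions. (1) There exists $\varepsilon\in(0,1)$ and, for each $\theta\in\Theta$, $y\in\mathcal{Y}$, there exists a measure $\mu_\theta(dx|y)$ on $\mathcal{X}$ such that $0<\mu_\theta(\mathcal{X}|y)<\infty$ and $$\varepsilon\,\mu_\theta(B|y)\le\int_B r_\theta(y,x'|x)\,\mu(dx')\le\frac{\mu_\theta(B|y)}{\varepsilon}$$ for all $x\in\mathcal{X}$, $B\in\mathcal{B}(\mathcal{X})$. (2) There exists a function $\psi:\mathcal{Y}\to[1,\infty)$ such that $|\partial_\theta^{\alpha}r_\theta(y,x'|x)|\le(\psi(y))^{|\alpha|}r_\theta(y,x'|x)$ for all $\theta\in\Theta$, $x,x'\in\mathcal{X}$, $y\in\mathcal{Y}$ and all $\alpha\in\mathbb{N}_0^d\setminus\{\mathbf{0}\}$ with $|\alpha|\le p$. (3) There exists a function $\phi:\mathcal{Y}\times\mathcal{X}\to[1,\infty)$ such that $r_\theta(y,x'|x)\le\phi(y,x')$ and $\int\phi(y,x'')\mu(dx'')<\infty$ for all $\theta\in\Theta$, $x,x'\in\mathcal{X}$, $y\in\mathcal{Y}$. Then $p_{\theta,\boldsymbol y}^{m:n}(x|\lambda)$ and $P_{\theta,\boldsymbol y}^{m:n}(B|\lambda)$ are $p$-times differentiable in $\theta$ for each $\theta\in\Theta$, $x\in\mathcal{X}$, $B\in\mathcal{B}(\mathcal{X})$, $\lambda\in\mathcal{P}(\mathcal{X})$, $n>m\ge0$ and any sequence $\boldsymbol y=\{y_n\}_{n\ge1}$ in $\mathcal{Y}$.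 Moreover, $$\partial_\theta^{\alpha}p_{\theta,\boldsymbol y}^{m:n}(x|\lambda)=f_{\theta,\boldsymbol y}^{\alpha,m:n}(x|\mathcal{E}_\lambda),\qquad \partial_\theta^{\alpha}P_{\theta,\boldsymbol y}^{m:n}(B|\lambda)=F_{\theta,\boldsymbol y}^{\alpha,m:n}(B|\mathcal{E}_\lambda)$$ for any multi-index $\alpha\in\mathbb{N}_0^d$, $|\alpha|\le p$.
   Context: Model. Integers $d,d_x,d_y,p\ge1$ are fixed; $\Theta\subset\mathbb{R}^d$ is a bounded open set; $\mathcal{X}\in\mathcal{B}(\mathbb{R}^{d_x})$, $\mathcal{Y}\in\mathcal{B}(\mathbb{R}^{d_y})$ ($\mathcal{B}(\cdot)$ denotes Borel sets); $\mu$, $\nu$ are measures on $\mathcal{X}$, $\mathcal{Y}$. $\mathcal{P}(\mathcal{X})$ is the set of probability measures and $\mathcal{M}_s(\mathcal{X})$ the set of finite signed measures on $\mathcal{X}$, with total variation norm $\|\cdot\|$. $p_\theta(x'|x)$ and $q_\theta(y|x)$ are $[0,\infty)$-valued functions of $\theta\in\Theta$, $x,x'\in\mathcal{X}$, $y\in\mathcal{Y}$ with $\int p_\theta(x'|x)\mu(dx')=\int q_\theta(y|x)\nu(dy)=1$, $p$-times differentiable in $\theta$; $r_\theta(y,x'|x)=q_\theta(y|x')p_\theta(x'|x)$. All integrands are tacitly Borel measurable. Multi-indices. For $\alpha,\beta\in\mathbb{N}_0^d$: $|\alpha|=\alpha_1+\cdots+\alpha_d$; $\beta\le\alpha$ means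 $\beta_i\le\alpha_i$ for all $i$; $\binom{\alpha}{\beta}=\prod_i\binom{\alpha_i}{\beta_i}$; $\partial_\theta^\alpha=\partial^{|\alpha|}/\partial\theta_1^{\alpha_1}\cdots\partial\theta_d^{\alpha_d}$; $\mathbf{0}$ is the zero multi-index. Filter. For a sequence $\boldsymbol y=\{y_n\}_{n\ge1}$ in $\mathcal{Y}$ and $n>m\ge0$: $r_{\theta,\boldsymbol y}^{m:m+1}(x'|x)=r_\theta(y_{m+1},x'|x)$, $r_{\theta,\boldsymbol y}^{m:n+1}(x'|x)=\int r_\theta(y_{n+1},x'|x'')r_{\theta,\boldsymbol y}^{m:n}(x''|x)\mu(dx'')$, $$p_{\theta,\boldsymbol y}^{m:n}(x|\lambda)=\frac{\int r_{\theta,\boldsymbol y}^{m:n}(x|x')\lambda(dx')}{\int\int r_{\theta,\boldsymbol y}^{m:n}(x''|x')\mu(dx'')\lambda(dx')},\qquad P_{\theta,\boldsymbol y}^{m:n}(B|\lambda)=\int_B p_{\theta,\boldsymbol y}^{m:n}(x'|\lambda)\mu(dx').$$ Vector measures. $\mathcal{L}_0(\mathcal{X})$ is the set of families $\Lambda=\{\lambda_\alpha:\alpha\in\mathbb{N}_0^d,|\alpha|\le p\}$ with $\lambda_\alpha\in\mathcal{M}_s(\mathcal{X})$ and $\lambda_{\mathbf{0}}\in\mathcal{P}(\mathcal{X})$; $\|\Lambda\|=\max_{|\alpha|\le p}\|\lambda_\alpha\|$. For $\lambda\in\mathcal{P}(\mathcal{X})$, $\mathcal{E}_\lambda\in\mathcal{L}_0(\mathcal{X})$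 has component $\mathbf{0}$ equal to $\lambda$ and all other components equal to zero. Derivative maps. For $\lambda\in\mathcal{M}_s(\mathcal{X})$, $\Lambda\in\mathcal{L}_0(\mathcal{X})$, $|\alpha|\le p$: $$r_{\theta,y}^\alpha(x|\lambda)=\int\partial_\theta^\alpha r_\theta(y,x|x')\lambda(dx'),\qquad s_{\theta,y}^\alpha(x|\Lambda)=\sum_{\beta\le\alpha}\binom{\alpha}{\beta}\frac{r_{\theta,y}^{\alpha-\beta}(x|\lambda_\beta)}{\int r_{\theta,y}^{\mathbf{0}}(x'|\lambda_{\mathbf{0}})\mu(dx')},$$ and recursively in $|\alpha|$: $f_{\theta,y}^{\mathbf{0}}(x|\Lambda)=s_{\theta,y}^{\mathbf{0}}(x|\Lambda)$ and $$f_{\theta,y}^\alpha(x|\Lambda)=s_{\theta,y}^\alpha(x|\Lambda)-\sum_{\beta\le\alpha,\,\beta\ne\alpha}\binom{\alpha}{\beta}f_{\theta,y}^\beta(x|\Lambda)\int s_{\theta,y}^{\alpha-\beta}(x'|\Lambda)\mu(dx').$$ $F_{\theta,y}^\alpha(B|\Lambda)=\int_B f_{\theta,y}^\alpha(x|\Lambda)\mu(dx)$, $F_{\theta,y}(\Lambda)=\{F_{\theta,y}^\alpha(\cdot|\Lambda):|\alpha|\le p\}\in\mathcal{L}_0(\mathcal{X})$. For $n\ge m\ge0$: $F_{\theta,\boldsymbol y}^{m:m}(\Lambda)=\Lambda$, $F_{\theta,\boldsymbol y}^{m:n+1}(\Lambda)=F_{\theta,y_{n+1}}(F_{\theta,\boldsymbol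 y}^{m:n}(\Lambda))$; $F_{\theta,\boldsymbol y}^{\alpha,m:n}(\cdot|\Lambda)$ is the component $\alpha$ of $F_{\theta,\boldsymbol y}^{m:n}(\Lambda)$; for $n>m$, $f_{\theta,\boldsymbol y}^{\alpha,m:n}(x|\Lambda)=f_{\theta,y_n}^\alpha(x|F_{\theta,\boldsymbol y}^{m:n-1}(\Lambda))$. *)

(* Defs.v *)
From HB Require Import structures.
From mathcomp Require Import all_boot all_order all_algebra.
From mathcomp Require Import all_classical all_reals all_analysis.
Set Implicit Arguments.
Unset Strict Implicit.
Unset Printing Implicit Defensive.
Import Order.TTheory GRing.Theory Num.Theory.
Import numFieldNormedType.Exports.
Local Open Scope classical_set_scope.
Local Open Scope ring_scope.

(* R^n with its Borel sigma-algebra. A Borel set X of R^n is kept as a set of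
   this type: a measure on X is a measure on R^n that is only evaluated on
   measurable subsets of X (or gives X full mass), and every integral over X is
   written with the domain X. *)
Definition borelRn (R : realType) (n : nat) :=
  g_sigma_algebraType (@open 'rV[R]_n).

Section MultiIndex.
Variables d p : nat.

(* Multi-indices of N^d of degree at most p; the entries of such a multi-index
   are automatically at most p, so that they form a finite type. *)
Definition midx := {a : {ffun 'I_d -> 'I_p.+1} | (\sum_(i < d) a i <= p)%N}.

Definition mcoef (a : midx) (i : 'I_d) : nat := val a i.

Definition mdeg (a : midx) : nat := \sum_(i < d) mcoef a i.

Definition mle (b a : midx) : bool := [forall i : 'I_d, (mcoef b i <= mcoef a i)%N].

Definition mbinom (a b : midx) : nat := (\prod_(i < d) 'C(mcoef a i, mcoef b i))%N.

Lemma midx0_subproof :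
  (\sum_(i < d) ([ffun=> ord0] : {ffun 'I_d -> 'I_p.+1}) i <= p)%N.
Proof. by rewrite big1 // => i _; rewrite ffunE. Qed.

Definition midx0 : midx := Sub [ffun=> ord0] midx0_subproof.

Lemma mcoef0 i : mcoef midx0 i = 0%N.
Proof. by rewrite /mcoef /= ffunE. Qed.

Lemma msub_subproof (a b : midx) :
  (\sum_(i < d) ([ffun i => inord (mcoef a i - mcoef b i)]
     : {ffun 'I_d -> 'I_p.+1}) i <= p)%N.
Proof.
apply: leq_trans (valP a); apply: leq_sum => i _; rewrite ffunE inordK ?leq_subr//.
by rewrite (leq_ltn_trans (leq_subr _ _))// ltn_ord.
Qed.

Definition msub (a b : midx) : midx :=
  Sub [ffun i => inord (mcoef a i - mcoef b i)] (msub_subproof a b).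

Lemma mcoef_sub a b i : mcoef (msub a b) i = (mcoef a i - mcoef b i)%N.
Proof.
rewrite {1}/mcoef /= ffunE inordK//.
by rewrite (leq_ltn_trans (leq_subr _ _))// ltn_ord.
Qed.

Lemma mdeg_lt (a b : midx) : mle b a -> b != a -> (mdeg b < mdeg a)%N.
Proof.
move=> /forallP ba nba.
have [le_ba eq_ba] := leqif_sum (I := 'I_d) (P := xpredT)
  (fun i _ => leqif_eq (ba i)).
rewrite ltn_neqAle; apply/andP; split; last exact: le_ba.
apply: contra_neqN nba => /eqP E.
move: eq_ba; rewrite -/(mdeg b) -/(mdeg a) E eqxx => /esym/forallP H.
by apply: val_inj; apply/ffunP => i; apply: val_inj; exact/eqP/H.
Qed.

End MultiIndex.

Section Differentiation.
Variables (R : realType) (d : nat).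
Implicit Type f : 'rV[R]_d -> R.

Definition partial (i : 'I_d) f : 'rV[R]_d -> R := 'D_(delta_mx 0 i) f.

(* d^|a| f / dt_1^(a_1) ... dt_d^(a_d), the derivations in t_d being applied
   first *)
Definition mpartial (p : nat) (a : midx d p) f : 'rV[R]_d -> R :=
  foldr (fun i g => iter (mcoef a i) (partial i) g) f (enum 'I_d).

(* k-times (Frechet) differentiable on the open set Theta: f is differentiable
   on Theta and its gradient is (k-1)-times differentiable there *)
Fixpoint ntimes_differentiable (k : nat) (Theta : set 'rV[R]_d) f : Prop :=
  if k is k'.+1 then
    (forall theta, Theta theta -> differentiable f theta) /\
    (forall i, ntimes_differentiable k' Theta (partial i f))
  else True.

End Differentiation.

Section SignedMeasures.
Context (disp : measure_display) (T : measurableType disp) (R : realType).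

(* integral with respect to a finite signed measure, by its Jordan
   decomposition *)
Definition charge_Rintegral (nu : {charge set T -> \bar R}) (D : set T)
    (f : T -> R) : R :=
  let P := cid (Hahn_decomposition nu) in
  let N := cid (projT2 P) in
  Rintegral (jordan_pos (projT2 N)) D f - Rintegral (jordan_neg (projT2 N)) D f.

(* the signed measure B |-> \int[mu]_(x in B `&` D) f x; the value when f is not
   integrable over D is a dummy *)
Definition density_charge (mu : {measure set T -> \bar R}) (D : set T)
    (f : T -> R) : {charge set T -> \bar R} :=
  if pselect (mu.-integrable setT (EFin \o (f \_ D))) is left intf
  then induced_charge intf
  else czero.

Lemma density_chargeE (mu : {measure set T -> \bar R}) (D : set T) (f : T -> R)
    (B : set T) : measurable D -> measurable B -> B `<=` D ->
  mu.-integrable D (EFin \o f) ->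
  density_charge mu D f B = (\int[mu]_(x in B) (f x)%:E)%E.
Proof.
move=> mD mB BD fi; rewrite /density_charge; case: pselect => [h|].
  rewrite /induced_charge; apply: eq_integral => x /set_mem xB /=.
  by rewrite patchE mem_set//; exact: BD.
case; rewrite (_ : _ \o _ = (EFin \o f) \_ D).
  by apply/integrable_restrict => //; rewrite setTI.
by apply/funext => x /=; rewrite !patchE; case: ifP.
Qed.

End SignedMeasures.

Section Filter.
Variables (R : realType) (d dx dy p : nat).
Variables (X : set (borelRn R dx)) (mu : {measure set (borelRn R dx) -> \bar R}).
(* pt theta x' x is p_theta(x'|x) and qt theta y x is q_theta(y|x) *)
Variable pt : 'rV[R]_d -> borelRn R dx -> borelRn R dx -> R.
Variable qt : 'rV[R]_d -> borelRn R dy -> borelRn R dx -> R.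

Local Notation state := (borelRn R dx).
Local Notation obs := (borelRn R dy).

(* r_theta(y,x'|x) *)
Definition rt (theta : 'rV[R]_d) (y : obs) (x' x : state) : R :=
  qt theta y x' * pt theta x' x.

(* r_{theta,ys}^{m:n}(x'|x), meaningful for m < n *)
Fixpoint rt_iter (theta : 'rV[R]_d) (ys : nat -> obs) (m n : nat)
    (x' x : state) : R :=
  if n is k.+1 then
    if m == k then rt theta (ys k.+1) x' x
    else \int[mu]_(x'' in X) (rt theta (ys k.+1) x' x'' * rt_iter theta ys m k x'' x)
  else 0.

(* p_{theta,ys}^{m:n}(x|lambda) *)
Definition filter_density (theta : 'rV[R]_d) (ys : nat -> obs) (m n : nat)
    (lambda : probability state R) (x : state) : R :=
  (\int[lambda]_(x' in X) rt_iter theta ys m n x x') /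
  (\int[lambda]_(x' in X) \int[mu]_(x'' in X) rt_iter theta ys m n x'' x').

(* P_{theta,ys}^{m:n}(B|lambda) *)
Definition filter_prob (theta : 'rV[R]_d) (ys : nat -> obs) (m n : nat)
    (lambda : probability state R) (B : set state) : R :=
  \int[mu]_(x in B) filter_density theta ys m n lambda x.

Definition vmeasure := midx d p -> {charge set state -> \bar R}.

(* E_lambda *)
Definition vmeasure_init (lambda : probability state R) : vmeasure :=
  fun a => if a == midx0 d p
           then charge_of_finite_measure lambda : {charge set _ -> \bar R}
           else czero.

(* r_{theta,y}^a(x|lambda) for a signed measure lambda *)
Definition rder (theta : 'rV[R]_d) (y : obs) (a : midx d p) (x : state)
    (lambda : {charge set state -> \bar R}) : R :=
  charge_Rintegral lambda X
    (fun x' => mpartial a (fun t => rt t y x x') theta).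

Definition sder (theta : 'rV[R]_d) (y : obs) (a : midx d p) (x : state)
    (L : vmeasure) : R :=
  \sum_(b : midx d p | mle b a)
    (mbinom a b)%:R *
    (rder theta y (msub a b) x (L b) /
     \int[mu]_(x' in X) rder theta y (midx0 d p) x' (L (midx0 d p))).

(* the recursion on |a| defining f^a, with k > |a| as structural argument; see
   fderE *)
Fixpoint fder_rec (k : nat) (theta : 'rV[R]_d) (y : obs) (a : midx d p)
    (x : state) (L : vmeasure) : R :=
  if k is k'.+1 then
    sder theta y a x L -
    \sum_(b : midx d p | mle b a && (b != a))
      (mbinom a b)%:R * fder_rec k' theta y b x L *
      \int[mu]_(x' in X) sder theta y (msub a b) x' L
  else 0.

Definition fder (theta : 'rV[R]_d) (y : obs) (a : midx d p) (x : state)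
    (L : vmeasure) : R :=
  fder_rec (mdeg a).+1 theta y a x L.

Lemma fderE theta y a x L :
  fder theta y a x L =
  sder theta y a x L -
  \sum_(b : midx d p | mle b a && (b != a))
    (mbinom a b)%:R * fder theta y b x L *
    \int[mu]_(x' in X) sder theta y (msub a b) x' L.
Proof.
suff H k k' b : (mdeg b < k)%N -> (mdeg b < k')%N ->
    fder_rec k theta y b x L = fder_rec k' theta y b x L.
  congr (_ - _); apply: eq_bigr => b /andP[ba bna]; congr (_ * _ * _).
  by apply: H => //; exact: mdeg_lt.
elim: k k' b => // k IH [//|k'] b bk bk' /=.
congr (_ - _); apply: eq_bigr => c /andP[cb cnb]; congr (_ * _ * _).
by apply: IH; apply: leq_trans (mdeg_lt cb cnb) _.
Qed.

Lemma fder0 theta y x L :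
  fder theta y (midx0 d p) x L = sder theta y (midx0 d p) x L.
Proof.
rewrite fderE big_pred0 ?subr0// => b; apply/negP => /andP[b0 nb0].
have := mdeg_lt b0 nb0; rewrite {2}/mdeg big1 ?ltn0// => i _; exact: mcoef0.
Qed.

(* F_{theta,y}(L) *)
Definition Fmap (theta : 'rV[R]_d) (y : obs) (L : vmeasure) : vmeasure :=
  fun a => density_charge mu X (fun x => fder theta y a x L).

(* F_{theta,ys}^{m:n}(L), meaningful for m <= n *)
Fixpoint Fmap_iter (theta : 'rV[R]_d) (ys : nat -> obs) (m n : nat)
    (L : vmeasure) : vmeasure :=
  if n is k.+1 then
    if (m <= k)%N then Fmap theta (ys k.+1) (Fmap_iter theta ys m k L) else L
  else L.

(* f_{theta,ys}^{a,m:n}(x|L), meaningful for m < n *)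
Definition fder_iter (theta : 'rV[R]_d) (ys : nat -> obs) (a : midx d p)
    (m n : nat) (x : state) (L : vmeasure) : R :=
  fder theta (ys n) a x (Fmap_iter theta ys m n.-1 L).

End Filter.

Arguments vmeasure_init {R} d {dx} p lambda _.

(* Main.v *)
Require Import Defs.
From HB Require Import structures.
From mathcomp Require Import all_boot all_order all_algebra.
From mathcomp Require Import all_classical all_reals all_analysis.
From mathcomp Require Import measurable_realfun ring lra.
Set Implicit Arguments.
Unset Strict Implicit.
Unset Printing Implicit Defensive.
Import Order.TTheory GRing.Theory Num.Theory.
Import numFieldNormedType.Exports.
Local Open Scope classical_set_scope.
Local Open Scope ring_scope.

(** One step of the filter multiplies the current density [g] (with respect to a
    finite measure [k]) by the kernel [r], integrates, and normalizes: the new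
    density is [u x / v] with [u x = \int r x x' g x' k(dx')] and
    [v = \int u dmu]. At the first step [k] is the initial distribution and
    [g = 1]; afterwards [k] is [mu] and [g] is the previous filter density. The
    recursion that defines [f^a] is the Leibniz rule of the identity [u = w v],
    solved for the derivatives of [w = u / v]: dividing by [v], the derivatives of
    [u] become the [s^a], and those of [v] become the integrals of the [s^a]. So the
    theorem is proved by induction over time. The invariant [filter_stage] says that
    the components of the vector measure have the successive derivatives in the
    parameter of the filter density as densities; [filter_stage_step] is the
    inductive step, and [filter_densityE] identifies the recursively normalized
    density with the quotient of iterated integrals that defines the filter.

    Derivatives are handled through jets: families [D] indexed by multi-indices such
    that the partial derivative in direction [i] of [D a] is [D (a + e_i)]. The
    iterated derivatives of a [p]-times differentiable function form a jet
    ([jet_mpartial]); as they are taken in a fixed order, this rests on the symmetry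
    of the second derivatives of a twice Frechet differentiable function
    ([partial_sym]). Conversely the component of order zero of a jet is [p]-times
    differentiable and the others are its derivatives ([jet_represents]). Jets are
    stable under products ([jet_mul]), under quotients ([jet_div]) and, when they are
    locally dominated by an integrable function, under integration
    ([jet_Rintegral]). The last point is dominated convergence for the remainders of
    the first-order expansions, which the mean value theorem bounds.

    Domination propagates along the steps. The assumptions on [psi] and [phi] bound
    all the derivatives of the kernel by a multiple of [phi y x], where [x] is the
    new state, and the minorization of the kernel makes [v] positive. Since [v] is continuous in the
    parameter, it is locally bounded away from zero, and the Leibniz equations then
    bound the derivatives of the new density, by induction on their order, by a
    multiple of [phi y x] that is uniform locally in the parameter. As [phi >= 1] is
    integrable, [mu] is finite on the state space, which gives access to Tonelli's
    theorem.

    Finally, the integrals with respect to signed measures that occur in [r^a] are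
    integrals against densities ([charge_Rintegral_density]). *)

(** * Differential calculus on row vectors *)

Section Gradient.
Variables (R : realType) (d : nat).
Implicit Types (f g : 'rV[R]_d -> R) (theta h v : 'rV[R]_d).

Lemma is_derive_line f theta v (s : R) :
  derivable f (theta + s *: v) v ->
  is_derive s 1 (fun t => f (theta + t *: v)) ('D_v f (theta + s *: v)).
Proof.
have E : (fun h : R => h^-1 *: (((fun t => f (theta + t *: v)) \o shift s) (h *: 1)
            - f (theta + s *: v)))
       = (fun h : R => h^-1 *: ((f \o shift (theta + s *: v)) (h *: v)
            - f (theta + s *: v))).
  apply/funext => h /=; congr (_ *: (f _ - _)).
  by rewrite scalerDl /GRing.scale /= mulr1 addrCA.
move=> dfv; split; first by rewrite /derivable E.
by rewrite /derive E.
Qed.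

Lemma mean_value_line f theta v (t : R) : 0 < t ->
  (forall s, 0 <= s <= t -> differentiable f (theta + s *: v)) ->
  exists2 s, 0 < s < t & f (theta + t *: v) - f theta = 'D_v f (theta + s *: v) * t.
Proof.
move=> t0 df.
have dl s : 0 <= s <= t ->
    is_derive s 1 (fun t => f (theta + t *: v)) ('D_v f (theta + s *: v)).
  by move=> st; apply: is_derive_line; apply/diff_derivable/df.
have [||s] := @MVT R (fun t => f (theta + t *: v))
    (fun t => 'D_v f (theta + t *: v)) 0 t t0.
- move=> s; rewrite in_itv/= => /andP[s0 st]; apply: dl; lra.
- apply: derivable_within_continuous => s; rewrite in_itv/= => st.
  by have [] := dl s st.
by rewrite in_itv/= scale0r addr0 subr0 => st E; exists s.
Qed.

Lemma derive_sum_partial f theta v : differentiable f theta ->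
  'D_v f theta = \sum_i partial i f theta * v 0 i.
Proof.
move=> df; rewrite deriveE// {1}[v]row_sum_delta linear_sum/=.
apply: eq_bigr => i _; rewrite linearZ/= /partial deriveE//.
by rewrite /GRing.scale/= mulrC.
Qed.

Lemma diff_expansion f theta : differentiable f theta -> forall e : R, 0 < e ->
  \forall h \near (0 : 'rV[R]_d), `|f (h + theta) - f theta
    - \sum_i partial i f theta * h 0 i| <= e * `|h|.
Proof.
move=> df e e0; have /diff_locally/eqaddoP/(_ e e0) := df.
apply: filterS => h /=; rewrite !fctE /=.
by rewrite -derive_sum_partial// deriveE// opprD addrA.
Qed.

(** Recognizes a Frechet derivative from a first-order expansion, without having
    to exhibit the differential as a continuous linear map; it serves to
    differentiate integrals, whose candidate gradient is explicit. *)
Lemma diff_of_expansion f theta (c : 'I_d -> R) :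
  (forall e : R, 0 < e -> \forall h \near (0 : 'rV[R]_d),
    `|f (h + theta) - f theta - \sum_i c i * h 0 i| <= e * `|h|) ->
  differentiable f theta /\ forall i, partial i f theta = c i.
Proof.
move=> H.
have lin : linear (fun h : 'rV[R]_d => \sum_i c i * h 0 i : R).
  move=> a u v; rewrite scaler_sumr -big_split/=; apply: eq_bigr => i _.
  by rewrite !mxE mulrDr mulrCA.
pose l : {linear 'rV[R]_d -> R} :=
  HB.pack (fun h : 'rV[R]_d => \sum_i c i * h 0 i : R)
    (GRing.isLinear.Build _ _ _ _ _ lin).
have lc : continuous l.
  move=> x; apply: differentiable_continuous.
  have -> : l = \sum_i (c i *: (fun h : 'rV[R]_d => h 0 i)) :> ('rV[R]_d -> R).
    by apply/funext => h; rewrite fct_sumE.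
  by apply: differentiable_sum => i; apply/differentiableZ/differentiable_coord.
have dE : 'd f theta = l :> ('rV[R]_d -> R).
  apply: diff_unique => //; apply/eqaddoP => e e0.
  by apply: filterS (H e e0) => h /=; rewrite !fctE/= opprD addrA.
have df : differentiable f theta.
  apply/diff_locallyP; rewrite dE; split=> //; apply/eqaddoP => e e0.
  by apply: filterS (H e e0) => h /=; rewrite !fctE/= opprD addrA.
split => // i; rewrite /partial deriveE// dE /l/= (bigD1 i)//= !mxE !eqxx mulr1.
by rewrite big1 ?addr0// => j ji; rewrite !mxE (negbTE ji) andbF mulr0.
Qed.

Lemma differentiable_shift f theta v : differentiable f (theta + v) ->
  differentiable (fun x => f (x + v)) theta /\
  forall i, partial i (fun x => f (x + v)) theta = partial i f (theta + v).
Proof.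
move=> df; apply: diff_of_expansion => e e0.
by apply: filterS (diff_expansion df e0) => h; rewrite addrA.
Qed.

Lemma sum_coord_delta (c : 'I_d -> R) i (t : R) :
  \sum_j c j * (t *: delta_mx 0 i : 'rV[R]_d) 0 j = c i * t.
Proof.
rewrite (bigD1 i)//= !mxE !eqxx mulr1 big1 ?addr0// => j ji.
by rewrite !mxE (negbTE ji) andbF !mulr0.
Qed.

Lemma norm_delta_le (i : 'I_d) : `|delta_mx 0 i : 'rV[R]_d| <= 1.
Proof.
rewrite /Num.norm/= mx_normrE; apply: bigmax_le => // -[j k] _ /=; rewrite mxE.
by case: (_ && _); rewrite ?normr1 ?normr0.
Qed.

Lemma norm_coord_le v i : `|v 0 i| <= `|v|.
Proof. by rewrite [leRHS]/Num.norm/= mx_normrE (le_bigmax _ _ (0, i)). Qed.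

(** The second difference along the axes [i] and [j] is the increment in direction
    [i] of [x |-> f (x + t e_j) - f x]. The mean value theorem turns it into [t]
    times a difference of two values of [partial i f] at distance at most [2 t] of
    [theta], which the first-order expansion of [partial i f] evaluates up to
    [o(t)]. *)
Lemma second_difference (i j : 'I_d) f theta :
  (\forall t \near theta, differentiable f t) ->
  differentiable (partial i f) theta ->
  forall e : R, 0 < e -> \forall t \near (0 : R)^'+,
  `|f (theta + t *: delta_mx 0 i + t *: delta_mx 0 j)
    - f (theta + t *: delta_mx 0 i) - f (theta + t *: delta_mx 0 j) + f theta
    - t ^+ 2 * partial j (partial i f) theta| <= e * t ^+ 2.
Proof.
move=> nf dpf e e0.
set ei : 'rV[R]_d := delta_mx 0 i; set ej : 'rV[R]_d := delta_mx 0 j.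
have e4 : 0 < e / 4 by rewrite divr_gt0.
have /nbhs_ballP[r1 /= r10 H1] := nf.
have /nbhs_ballP[r2 /= r20 H2] := diff_expansion dpf e4.
near=> t.
have t0 : 0 < t by near: t; exact: nbhs_right_gt.
have tr1 : 2 * t < r1.
  rewrite -ltr_pdivlMl//; near: t; apply: nbhs_right_lt; rewrite mulr_gt0//.
have tr2 : 2 * t < r2.
  rewrite -ltr_pdivlMl//; near: t; apply: nbhs_right_lt; rewrite mulr_gt0//.
have nst s u : 0 <= s <= t -> 0 <= u <= t -> `|s *: ei + u *: ej| <= 2 * t.
  move=> /andP[s0 st] /andP[u0 ut]; rewrite (le_trans (ler_normD _ _))//.
  rewrite !normrZ (ger0_norm s0) (ger0_norm u0).
  have := norm_delta_le i; have := norm_delta_le j; rewrite -/ei -/ej => A B.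
  have := ler_wpM2l s0 B; have := ler_wpM2l u0 A; lra.
have dst s u : 0 <= s <= t -> 0 <= u <= t ->
    differentiable f (theta + u *: ej + s *: ei).
  move=> hs hu; apply: H1; rewrite -ball_normE/=.
  rewrite -addrA opprD addNKr normrN addrC.
  exact: le_lt_trans (nst s u hs hu) tr1.
have t0t : 0 <= t <= t by rewrite lexx ltW.
have t00 : 0 <= (0 : R) <= t by rewrite lexx ltW.
pose g x := f (x + t *: ej) - f x.
have dg s : 0 <= s <= t -> differentiable g (theta + s *: ei).
  move=> hs; apply: differentiableB.
    by apply: (differentiable_shift _).1; rewrite addrAC; exact: dst.
  by have := dst s 0 hs t00; rewrite scale0r addr0.
have [s st E] := mean_value_line t0 dg.
have hs : 0 <= s <= t by lra.
have [df1 Df1] : differentiable (fun x => f (x + t *: ej)) (theta + s *: ei) /\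
    forall k, partial k (fun x => f (x + t *: ej)) (theta + s *: ei) =
      partial k f (theta + s *: ei + t *: ej).
  by apply: differentiable_shift; rewrite addrAC; exact: dst.
have df2 : differentiable f (theta + s *: ei).
  by have := dst s 0 hs t00; rewrite scale0r addr0.
have Dg : 'D_ei g (theta + s *: ei) =
    partial i f (theta + s *: ei + t *: ej) - partial i f (theta + s *: ei).
  by rewrite -Df1; exact: (deriveB (diff_derivable df1) (diff_derivable df2)).
have H3 h : `|h| < r2 -> `|partial i f (h + theta) - partial i f theta
    - \sum_k partial k (partial i f) theta * h 0 k| <= e / 4 * `|h|.
  by move=> hr; apply: H2; rewrite -ball_normE/= sub0r normrN.
(* the expansion is used at both ends of the increment, to share one estimate *)
have X1 := H3 (s *: ei + t *: ej).
have X2 := H3 (s *: ei + 0 *: ej).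
have expand a b : \sum_k partial k (partial i f) theta * (a *: ei + b *: ej) 0 k
   = a * partial i (partial i f) theta + b * partial j (partial i f) theta.
  rewrite -derive_sum_partial// deriveE// linearD !linearZ/= /partial !deriveE//.
rewrite !expand in X1, X2.
have {}X1 : `|partial i f (theta + s *: ei + t *: ej) - partial i f theta -
   (s * partial i (partial i f) theta + t * partial j (partial i f) theta)| <= e/4 * (2 * t).
  have -> : theta + s *: ei + t *: ej = s *: ei + t *: ej + theta.
    by rewrite [RHS]addrC addrA.
  apply: le_trans (X1 _) _.
    exact: le_lt_trans (nst s t hs t0t) tr2.
  by apply: ler_wpM2l; [exact: ltW|exact: nst].
have {}X2 : `|partial i f (theta + s *: ei) - partial i f theta -
   (s * partial i (partial i f) theta + 0 * partial j (partial i f) theta)| <= e/4 * (2 * t).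
  have -> : theta + s *: ei = s *: ei + 0 *: ej + theta.
    by rewrite scale0r addr0 addrC.
  apply: le_trans (X2 _) _.
    exact: le_lt_trans (nst s 0 hs t00) tr2.
  by apply: ler_wpM2l; [exact: ltW|exact: nst].
have -> : f (theta + t *: ei + t *: ej) - f (theta + t *: ei) - f (theta + t *: ej)
   + f theta = g (theta + t *: ei) - g theta by rewrite /g; ring.
rewrite E Dg expr2 -mulrA [X in `|X - _|]mulrC -mulrBr normrM (gtr0_norm t0).
rewrite mulrCA; apply: ler_wpM2l; first exact: ltW.
move: X1 X2; set A := partial i f _; set B := partial i f _; set C := partial i f _.
set Pii := partial i (partial i f) theta; set Pji := partial j _ _.
rewrite !ler_norml => /andP[? ?] /andP[? ?]; apply/andP; split; lra.
Unshelve. all: by end_near. Qed.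

Let dist_aux (D D' u v w a b e : R) :
  `|D - u - v + w - a| <= e -> `|D' - v - u + w - b| <= e -> D' = D -> `|a - b| <= e + e.
Proof.
move=> H1 H2 DD; rewrite DD in H2.
have -> : a - b = (D - v - u + w - b) - (D - u - v + w - a) by ring.
exact: le_trans (ler_normB _ _) (lerD H2 H1).
Qed.

(** The second difference does not depend on the order of the two axes, so that
    both mixed derivatives are its limit after division by [t ^+ 2]. *)
Lemma partial_sym (i j : 'I_d) f theta :
  (\forall t \near theta, differentiable f t) ->
  differentiable (partial i f) theta -> differentiable (partial j f) theta ->
  partial j (partial i f) theta = partial i (partial j f) theta.
Proof.
move=> nf di dj; apply/eqP; rewrite -subr_eq0 -normr_le0; apply/ler_addgt0Pl => e e0.
rewrite addr0.
have e2 : 0 < e / 2 by rewrite divr_gt0.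
have S1 := @second_difference i j f theta nf di (e / 2) e2.
have S2 := @second_difference j i f theta nf dj (e / 2) e2.
have [t [/= t0 [H1 H2]]] := filter_ex (filterI (nbhs_right_gt (0 : R)) (filterI S1 S2)).
have t2 : 0 < t ^+ 2 by rewrite exprn_gt0.
rewrite -(ler_pM2l t2) -[X in X * `|_|](gtr0_norm t2) -normrM mulrBr.
have := dist_aux H1 H2; rewrite -mulrDl -splitr [e * _]mulrC; apply.
by congr f; exact: addrAC.
Qed.

End Gradient.

(** * Multi-indices *)

Section MultiIndexArithmetic.
Variables d p : nat.
Implicit Types (a b c : midx d p) (i j : 'I_d).

Lemma midx_ext a b : (forall i, mcoef a i = mcoef b i) -> a = b.
Proof.
by move=> H; apply/val_inj/ffunP => i; apply/val_inj; exact: H.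
Qed.

Lemma mdeg_le a : (mdeg a <= p)%N. Proof. exact: (valP a). Qed.

Lemma mleP b a : reflect (forall i, (mcoef b i <= mcoef a i)%N) (mle b a).
Proof. exact: forallP. Qed.

Lemma mle_refl a : mle a a. Proof. by apply/mleP. Qed.

Lemma mdeg0 : mdeg (midx0 d p) = 0%N.
Proof. by rewrite /mdeg big1// => i _; rewrite mcoef0. Qed.

Lemma mdeg_eq0 a : (mdeg a == 0%N) = (a == midx0 d p).
Proof.
apply/eqP/eqP => [/eqP|->]; last exact: mdeg0.
rewrite sum_nat_eq0 => /forallP H; apply: midx_ext => i.
by rewrite mcoef0; exact/eqP/H.
Qed.

Lemma mdeg_sub_le a b : (mdeg (msub a b) <= mdeg a)%N.
Proof. by apply: leq_sum => i _; rewrite mcoef_sub leq_subr. Qed.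

Lemma mdeg_le_mle b a : mle b a -> (mdeg b <= mdeg a)%N.
Proof. by move=> /mleP ba; apply: leq_sum. Qed.

Lemma msubn a : msub a a = midx0 d p.
Proof. by apply: midx_ext => i; rewrite mcoef_sub mcoef0 subnn. Qed.

Lemma mbinomn a : mbinom a a = 1%N.
Proof. by rewrite /mbinom big1// => i _; rewrite binn. Qed.

Lemma mle0 a : mle a (midx0 d p) = (a == midx0 d p).
Proof.
apply/mleP/eqP => [H|-> //]; apply: midx_ext => i; apply/eqP.
by have := H i; rewrite mcoef0 leqn0.
Qed.

Lemma sum_mle0 (R : nmodType) (F : midx d p -> R) :
  (\sum_(a | mle a (midx0 d p)) F a = F (midx0 d p))%R.
Proof. by rewrite (eq_bigl _ _ mle0) big_pred1_eq. Qed.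

Lemma mbinom_eq0 a b : ~~ mle b a -> mbinom a b = 0%N.
Proof.
rewrite /mle negb_forall => /existsP[i]; rewrite -ltnNge => ba.
by rewrite /mbinom (bigD1 i)//= bin_small.
Qed.

(** Adds one derivation in direction [i]. The value at multi-indices of maximal
    degree is a default, hence the hypothesis [mdeg a < p] in what follows. *)
Definition mincr a i : midx d p :=
  insubd a [ffun j => inord (mcoef a j + (j == i))].

Let sum_indicator i : (\sum_(j < d) (j == i) = 1)%N.
Proof. by rewrite (bigD1 i)//= eqxx big1 // => j /negbTE ->. Qed.

Lemma mcoef_incr a i j : (mdeg a < p)%N ->
  mcoef (mincr a i) j = (mcoef a j + (j == i))%N.
Proof.
move=> ap.
have coefE k : nat_of_ord (([ffun j => inord (mcoef a j + (j == i))]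
    : {ffun 'I_d -> 'I_p.+1}) k) = (mcoef a k + (k == i))%N.
  rewrite ffunE inordK//; case: eqVneq => [->|_]; last by rewrite addn0 ltn_ord.
  rewrite addn1 ltnS (leq_trans _ ap)// ltnS /mdeg (bigD1 i)//=.
  exact: leq_addr.
rewrite {1}/mcoef val_insubd (eq_bigr _ (fun k _ => coefE k)) big_split/=.
by rewrite sum_indicator addn1 ap coefE.
Qed.

Lemma mdeg_incr a i : (mdeg a < p)%N -> mdeg (mincr a i) = (mdeg a).+1.
Proof.
move=> ap; rewrite /mdeg (eq_bigr _ (fun j _ => mcoef_incr i j ap)) big_split/=.
by rewrite sum_indicator addn1.
Qed.

Definition mdecr a i : midx d p := msub a (mincr (midx0 d p) i).

Lemma mcoef_decr a i j : (0 < p)%N -> mcoef (mdecr a i) j = (mcoef a j - (j == i))%N.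
Proof. by move=> p0; rewrite mcoef_sub mcoef_incr ?mdeg0// mcoef0. Qed.

Lemma mdeg_decr a i : (0 < mcoef a i)%N -> mdeg a = (mdeg (mdecr a i)).+1.
Proof.
move=> ai; have p0 : (0 < p)%N by rewrite (leq_trans ai)// -ltnS ltn_ord.
rewrite /mdeg (bigD1 i)//= [in RHS](bigD1 i)//= mcoef_decr// eqxx -addSn.
rewrite subn1 prednK//; congr (_ + _)%N; apply: eq_bigr => j /negbTE ji.
by rewrite mcoef_decr// ji subn0.
Qed.

Lemma mdecrK a i : (0 < mcoef a i)%N -> mincr (mdecr a i) i = a.
Proof.
move=> ai; have p0 : (0 < p)%N by rewrite (leq_trans ai)// -ltnS ltn_ord.
have ap : (mdeg (mdecr a i) < p)%N by rewrite -mdeg_decr// mdeg_le.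
apply: midx_ext => j; rewrite mcoef_incr// mcoef_decr//.
by case: eqVneq => [->|_]; rewrite ?subnK// subn0 addn0.
Qed.

Lemma mincrK a i : (mdeg a < p)%N -> mdecr (mincr a i) i = a.
Proof.
move=> ap; apply: midx_ext => j.
by rewrite mcoef_decr ?mcoef_incr ?addnK// (leq_trans _ ap).
Qed.

Lemma midx_neq0 a : a != midx0 d p -> exists i, (0 < mcoef a i)%N.
Proof.
rewrite -mdeg_eq0 -lt0n => a0; apply/existsP; move: a0.
apply: contraTT; rewrite negb_exists => /forallP H.
by rewrite -leqNgt leqn0 sum_nat_eq0; apply/forallP => i; rewrite -leqn0 leqNgt H.
Qed.

Lemma midx_ind (P : midx d p -> Prop) : P (midx0 d p) ->
  (forall a i, (mdeg a < p)%N -> P a -> P (mincr a i)) -> forall a, P a.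
Proof.
move=> P0 PS a; have [n] := ubnP (mdeg a); elim: n a => // n IH a.
have [-> //|/midx_neq0[i ai]] := eqVneq a (midx0 d p).
rewrite (mdeg_decr ai) ltnS => an; rewrite -(mdecrK ai); apply: PS.
  by rewrite -mdeg_decr// mdeg_le.
exact: IH.
Qed.

Lemma mbinom_incr a b i : (mdeg a < p)%N -> mbinom (mincr a i) b =
  (mbinom a b + (if 0 < mcoef b i then mbinom a (mdecr b i) else 0))%N.
Proof.
move=> ap; have p0 : (0 < p)%N by rewrite (leq_trans _ ap).
rewrite /mbinom (bigD1 i)//= [in X in (X + _)%N](bigD1 i)//=.
rewrite [X in (if _ then X else _)](bigD1 i)//=.
rewrite mcoef_incr// mcoef_decr// eqxx addn1.
rewrite (eq_bigr (fun j => 'C(mcoef a j, mcoef b j))); last first.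
  by move=> j /negbTE ji; rewrite mcoef_incr// ji addn0.
rewrite [in X in (if _ then X else _)](eq_bigr (fun j => 'C(mcoef a j, mcoef b j))); last first.
  by move=> j /negbTE ji; rewrite mcoef_decr// ji subn0.
case: (mcoef b i) => [|k] /=; first by rewrite !bin0 addn0.
by rewrite subn1/= binS mulnDl.
Qed.

(** The combinatorial part of the Leibniz rule, with a general [F b c] in place of
    a product of derivatives of orders [b] and [c]: differentiating a Leibniz sum
    once more in direction [i] raises either index, and Pascal's identity collects
    the two groups of terms. *)
Lemma pascal_sum (R : pzRingType) (F : midx d p -> midx d p -> R) a i :
  (mdeg a < p)%N ->
  \sum_(b | mle b a) (mbinom a b)%:R *
    (F (mincr b i) (msub a b) + F b (mincr (msub a b) i)) =
  \sum_(b | mle b (mincr a i)) (mbinom (mincr a i) b)%:R * F b (msub (mincr a i) b).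
Proof.
move=> ap; have p0 : (0 < p)%N by rewrite (leq_trans _ ap).
rewrite [RHS](eq_bigr (fun b => (mbinom a b)%:R * F b (msub (mincr a i) b) +
  (if (0 < mcoef b i)%N then
     (mbinom a (mdecr b i))%:R * F b (msub (mincr a i) b) else 0))); last first.
  move=> b _; rewrite mbinom_incr// natrD mulrDl.
  by case: ifP; rewrite ?mul0r.
rewrite [RHS]big_split/= addrC.
under eq_bigr do rewrite mulrDr.
rewrite big_split/=; congr (_ + _); last first.
  rewrite big_mkcond [RHS]big_mkcond/=; apply: eq_bigr => b _.
  case: ifPn => [/mleP ba|/mbinom_eq0->]; last by rewrite mul0r if_same.
  rewrite ifT; last by apply/mleP => j; rewrite mcoef_incr// (leq_trans (ba j))// leq_addr.
  congr (_ * F _ _); apply: midx_ext => j.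
  have sp : (mdeg (msub a b) < p)%N by rewrite (leq_ltn_trans (mdeg_sub_le _ _)).
  by rewrite mcoef_sub !mcoef_incr// mcoef_sub addnBAC.
rewrite -big_mkcondr/= [RHS](reindex_onto (mincr^~ i) (mdecr^~ i))/=; last first.
  by move=> b /andP[_]; exact: mdecrK.
have bp b : mle b a -> (mdeg b < p)%N.
  by move=> ba; apply: leq_ltn_trans ap; exact: mdeg_le_mle.
apply: eq_big => [b|b ba]; last first.
  rewrite mincrK ?bp//; congr (_ * F _ _); apply: midx_ext => j.
  by have bp' := bp b ba; rewrite !mcoef_sub !mcoef_incr// subnDr.
apply/idP/idP => [ba|/andP[/andP[/mleP ba bi] /eqP bK]].
  have bp' := bp b ba; rewrite mincrK// eqxx andbT mcoef_incr// eqxx addn1 andbT.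
  by apply/mleP => j; rewrite !mcoef_incr// leq_add2r; exact/mleP.
have bp' : (mdeg b < p)%N.
  by rewrite -bK -mdeg_decr// mdeg_le.
by apply/mleP => j; have := ba j; rewrite !mcoef_incr// leq_add2r.
Qed.

End MultiIndexArithmetic.

(** * Jets *)

Section Jets.
Variables (R : realType) (d p : nat) (Theta : set 'rV[R]_d).
Hypothesis openTheta : open Theta.
Implicit Types (f g : 'rV[R]_d -> R) (theta : 'rV[R]_d) (a b : midx d p)
  (D : midx d p -> 'rV[R]_d -> R).

Let near_Theta theta (P : 'rV[R]_d -> Prop) : Theta theta ->
  (forall t, Theta t -> P t) -> \forall t \near theta, P t.
Proof.
move=> Tt H; have : nbhs theta Theta by exact: open_nbhs_nbhs.
exact: filterS.
Qed.

Lemma eq_partial_on f g : (forall t, Theta t -> f t = g t) ->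
  forall i theta, Theta theta -> partial i f theta = partial i g theta.
Proof. by move=> fg i theta Tt; apply: near_eq_derive; exact: near_Theta. Qed.

Lemma eq_differentiable_on f g : (forall t, Theta t -> f t = g t) ->
  forall theta, Theta theta -> differentiable f theta -> differentiable g theta.
Proof.
move=> fg theta Tt df; have nfg := near_Theta Tt fg.
have [e e0|//] := @diff_of_expansion _ _ g theta (fun i => partial i f theta).
move: nfg; rewrite (near_shift 0) subr0 => nfg.
apply: filterS2 nfg (diff_expansion df e0) => h /=.
by rewrite -(fg _ Tt) => <-.
Qed.

Lemma eq_ntimes_differentiable k f g : (forall t, Theta t -> f t = g t) ->
  ntimes_differentiable k Theta f -> ntimes_differentiable k Theta g.
Proof.
elim: k f g => //= k IH f g fg [df pf]; split => [t Tt|i].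
  exact: (eq_differentiable_on fg Tt (df t Tt)).
by apply: IH (pf i) => t; exact: eq_partial_on.
Qed.

Let lpartial (s : seq 'I_d) f := foldr (@partial R d) f s.

Let lpartial_differentiable k s f : ntimes_differentiable k Theta f ->
  (size s < k)%N -> forall t, Theta t -> differentiable (lpartial s f) t.
Proof.
elim: k s f => // k IH s f /= [df pf]; case: (lastP s) => // s' i.
rewrite size_rcons ltnS /lpartial foldr_rcons => sk; exact: IH.
Qed.

Let lpartial_swap k i j s f : ntimes_differentiable k Theta f ->
  ((size s).+1 < k)%N -> forall t, Theta t ->
  lpartial (i :: j :: s) f t = lpartial (j :: i :: s) f t.
Proof.
move=> nf sk t Tt; apply: (@partial_sym _ _ j i (lpartial s f)).
- apply: (near_Theta Tt) => u; apply: (lpartial_differentiable nf); exact: ltnW.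
- exact: (lpartial_differentiable (s := j :: s) nf sk Tt).
- exact: (lpartial_differentiable (s := i :: s) nf sk Tt).
Qed.

Let lpartial_move k i s1 s2 f : ntimes_differentiable k Theta f ->
  (size (s1 ++ s2) < k)%N -> forall t, Theta t ->
  lpartial (i :: s1 ++ s2) f t = lpartial (s1 ++ i :: s2) f t.
Proof.
move=> nf; elim: s1 => [_ t _|j s1 IH sk t Tt]; first exact: erefl.
rewrite [LHS](lpartial_swap i j nf sk Tt).
exact: (eq_partial_on (IH (ltnW sk)) j Tt).
Qed.

(* the derivations performed by [mpartial a], the outermost one first *)
Let mseq a := flatten [seq nseq (mcoef a i) i | i <- enum 'I_d].

Let mpartialE a f : mpartial a f = lpartial (mseq a) f.
Proof.
rewrite /mpartial /mseq; elim: (enum _) => //= i s ->.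
rewrite /lpartial foldr_cat; elim: (mcoef a i) => //= n IH.
by rewrite IH.
Qed.

Let size_mseq a : size (mseq a) = mdeg a.
Proof.
rewrite size_flatten /shape -map_comp sumnE big_map big_enum/=.
by apply: eq_bigr => i _; rewrite size_nseq.
Qed.

Let mseq_incr a i : (mdeg a < p)%N ->
  exists s1 s2, mseq a = s1 ++ s2 /\ mseq (mincr a i) = s1 ++ i :: s2.
Proof.
move=> ap; have iE : i \in enum 'I_d by rewrite mem_enum.
have := enum_uniq 'I_d; rewrite /mseq; case/splitPr: iE => e1 e2.
rewrite cat_uniq /= negb_or => /and3P[_ /andP[ie1 _] /andP[ie2 _]].
have E e : i \notin e -> [seq nseq (mcoef (mincr a i) j) j | j <- e] =
    [seq nseq (mcoef a j) j | j <- e].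
  move=> ie; apply/eq_in_map => j je; rewrite mcoef_incr//.
  by rewrite (_ : (j == i) = false) ?addn0//; apply: contraNF ie => /eqP <-.
exists (flatten [seq nseq (mcoef a j) j | j <- e1]).
exists (nseq (mcoef a i) i ++ flatten [seq nseq (mcoef a j) j | j <- e2]).
rewrite !map_cat !flatten_cat /= !E//; split => //.
by rewrite mcoef_incr// eqxx addn1.
Qed.

Lemma mpartial_id f : mpartial (midx0 d p) f = f.
Proof.
rewrite mpartialE (_ : mseq _ = [::])//; apply: size0nil.
by rewrite size_mseq mdeg0.
Qed.

(** The derivations of [mpartial] come in a fixed order, so that a new outermost
    derivation has to be moved to its place by symmetry of the second
    derivatives. *)
Lemma partial_mpartial a i f theta : ntimes_differentiable p Theta f ->
  (mdeg a < p)%N -> Theta theta ->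
  partial i (mpartial a f) theta = mpartial (mincr a i) f theta.
Proof.
move=> nf ap Tt; have [s1 [s2 [Ea Ei]]] := mseq_incr i ap.
rewrite !mpartialE Ea Ei -(lpartial_move i nf)//.
by rewrite -Ea size_mseq.
Qed.

(** A jet is a family that contains the derivatives of its own members. Proving
    that explicit candidates form a jet takes one derivation at a time, and gives
    both differentiability up to order [p] and the value of all the derivatives,
    see [jet_represents]. *)
Definition jet D := forall a theta, (mdeg a < p)%N -> Theta theta ->
  differentiable (D a) theta /\
  forall i, partial i (D a) theta = D (mincr a i) theta.

Lemma jet_mpartial f : ntimes_differentiable p Theta f ->
  jet (fun a => mpartial a f).
Proof.
move=> nf a theta ap Tt; split => [|i]; last exact: partial_mpartial.
by rewrite mpartialE; apply: (lpartial_differentiable nf) => //; rewrite size_mseq.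
Qed.

Lemma jet_unique D D' : jet D -> jet D' ->
  (forall t, Theta t -> D (midx0 d p) t = D' (midx0 d p) t) ->
  forall a t, Theta t -> D a t = D' a t.
Proof.
move=> jD jD' E0; elim/midx_ind => // a i ap IH t Tt.
by rewrite -(jD _ _ ap Tt).2 -(jD' _ _ ap Tt).2; exact: eq_partial_on.
Qed.

Lemma jet_ntimes_differentiable D : jet D ->
  ntimes_differentiable p Theta (D (midx0 d p)).
Proof.
move=> jD; suff H k a : (mdeg a + k <= p)%N -> ntimes_differentiable k Theta (D a).
  by apply: H; rewrite mdeg0.
elim: k a => //= k IH a; rewrite addnS => ak.
have ap : (mdeg a < p)%N by rewrite (leq_trans _ ak)// ltnS leq_addr.
split => [t Tt|i]; first by have [] := jD a t ap Tt.
apply: (@eq_ntimes_differentiable k (D (mincr a i))).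
  by move=> t Tt; have [_ ->] := jD a t ap Tt.
by apply: IH; rewrite mdeg_incr// addSn.
Qed.

(** The way back from jets to iterated derivatives: a jet is determined by its
    component of order zero. *)
Lemma jet_represents D f : jet D ->
  (forall t, Theta t -> f t = D (midx0 d p) t) ->
  ntimes_differentiable p Theta f /\
  forall a t, Theta t -> mpartial a f t = D a t.
Proof.
move=> jD fD; have nf : ntimes_differentiable p Theta f.
  apply: eq_ntimes_differentiable (jet_ntimes_differentiable jD) => t Tt.
  by rewrite fD.
split => //; apply: (jet_unique (jet_mpartial nf) jD) => t Tt.
by rewrite mpartial_id fD.
Qed.

Lemma jet_cst (c : R) : jet (fun a _ => if a == midx0 d p then c else 0).
Proof.
move=> a t ap Tt; split => [|i]; first exact: differentiable_cst.
rewrite [RHS]ifF; first exact: derive_cst.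
by apply/negbTE; rewrite -mdeg_eq0 mdeg_incr.
Qed.

Let diffD f g theta : differentiable f theta -> differentiable g theta ->
  differentiable (fun t => f t + g t) theta /\
  forall i, partial i (fun t => f t + g t) theta = partial i f theta + partial i g theta.
Proof.
move=> df dg; split; first exact: differentiableD.
by move=> i; exact: (deriveD (diff_derivable df) (diff_derivable dg)).
Qed.

Let diffM f g theta : differentiable f theta -> differentiable g theta ->
  differentiable (fun t => f t * g t) theta /\
  forall i, partial i (fun t => f t * g t) theta =
    partial i f theta * g theta + f theta * partial i g theta.
Proof.
move=> df dg; split; first exact: differentiableM.
move=> i; rewrite addrC [X in _ = _ + X]mulrC.
exact: (deriveM (diff_derivable df) (diff_derivable dg)).
Qed.

Let diff_cst (c : R) theta : differentiable (fun _ : 'rV[R]_d => c) theta /\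
  forall i, partial i (fun=> c) theta = 0.
Proof. by split => [|i]; [exact: differentiable_cst|exact: derive_cst]. Qed.

Let diff_sum (I : finType) (P : pred I) (c : I -> R) (F : I -> 'rV[R]_d -> R) theta :
  (forall j, P j -> differentiable (F j) theta) ->
  differentiable (fun t => \sum_(j | P j) c j * F j t) theta /\
  forall i, partial i (fun t => \sum_(j | P j) c j * F j t) theta =
    \sum_(j | P j) c j * partial i (F j) theta.
Proof.
move=> dF; elim: (index_enum I) => [|k s [IHd IHp]].
  have := diff_cst 0 theta.
  under [in X in _ -> X]eq_fun do rewrite big_nil.
  by move=> [? H]; split => // i; rewrite big_nil.
have [Pk|Pk] := boolP (P k); last first.
  under eq_fun do rewrite big_cons (negbTE Pk).
  by split => // i; rewrite big_cons (negbTE Pk).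
have [dc pc] := diff_cst (c k) theta.
have [dM pM] := diffM dc (dF k Pk).
have [dA pA] := diffD dM IHd.
under eq_fun do rewrite big_cons Pk.
by split => // i; rewrite big_cons Pk pA pM pc mul0r add0r IHp.
Qed.

Let msub_lt a b : (mdeg a < p)%N -> (mdeg (msub a b) < p)%N.
Proof. exact/leq_ltn_trans/mdeg_sub_le. Qed.

Let mle_lt a b : (mdeg a < p)%N -> mle b a -> (mdeg b < p)%N.
Proof. by move=> ap /mdeg_le_mle; move/leq_ltn_trans; exact. Qed.

Lemma jet_mul D G : jet D -> jet G ->
  jet (fun a t => \sum_(b | mle b a) (mbinom a b)%:R * (D b t * G (msub a b) t)).
Proof.
move=> jD jG a t ap Tt.
have dDG b : mle b a -> differentiable (D b) t /\ differentiable (G (msub a b)) t.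
  by move=> ba; have [? _] := jD b t (mle_lt ap ba) Tt;
     have [? _] := jG (msub a b) t (msub_lt b ap) Tt.
have [b ba|dS pS] := @diff_sum _ (fun b : midx d p => mle b a) (fun b => (mbinom a b)%:R)
    (fun b t => D b t * G (msub a b) t) t.
  by have [dD dG] := dDG b ba; have [] := diffM dD dG.
split => // i; rewrite pS -(@pascal_sum _ _ _ (fun b c => D b t * G c t))//.
apply: eq_bigr => b ba; congr (_ * _).
have [dD dG] := dDG b ba; have [_ ->] := diffM dD dG.
by rewrite (jD _ _ (mle_lt ap ba) Tt).2 (jG _ _ (msub_lt b ap) Tt).2.
Qed.

(** If [U = D * V] in the sense of Leibniz, with [V] invertible, then [D] consists
    of the derivatives of the quotient. The equation of index [a] expresses [D a]
    by the [D b] of smaller degree, whence differentiability by induction on the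
    degree. Differentiating it in direction [i] and comparing with the equation of
    index [mincr a i] through [pascal_sum], all terms cancel but
    [(partial i (D a) - D (mincr a i)) * V 0]. *)
Lemma jet_div U V D : jet U -> jet V ->
  (forall t, Theta t -> V (midx0 d p) t != 0) ->
  (forall a t, Theta t ->
    \sum_(b | mle b a) (mbinom a b)%:R * (D b t * V (msub a b) t) = U a t) ->
  jet D.
Proof.
move=> jU jV V0 DV a.
have [n] := ubnP (mdeg a); elim: n a => // n IH a; rewrite ltnS => an t ap Tt.
have p0 : (0 < p)%N by rewrite (leq_trans _ ap).
have dV b : differentiable (V (msub a b)) t.
  by have [] := jV (msub a b) t (msub_lt b ap) Tt.
have dDb b : mle b a && (b != a) -> (mdeg b < p)%N /\ (differentiable (D b) t /\
    forall i, partial i (D b) t = D (mincr b i) t).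
  move=> /andP[ba nba]; have ban := mdeg_lt ba nba.
  have bp := mle_lt ap ba; split => //; apply: IH => //; exact: leq_trans ban an.
have DaE u : Theta u -> D a u = (U a u + (-1) * (\sum_(b | mle b a && (b != a))
    (mbinom a b)%:R * (D b u * V (msub a b) u))) * (V (midx0 d p) u)^-1.
  move=> Tu; rewrite -DV// (bigD1 a) ?mle_refl//= mbinomn msubn mul1r mulN1r addrK.
  by rewrite mulfK// V0.
have dDa : differentiable (D a) t.
  refine (eq_differentiable_on (fun u Tu => esym (DaE u Tu)) Tt _).
  have [dU _] := jU a t ap Tt.
  have [b ba|dS _] := @diff_sum _ (fun b : midx d p => mle b a && (b != a))
      (fun b => (mbinom a b)%:R) (fun b t => D b t * V (msub a b) t) t.
    by have [_ [dD _]] := dDb b ba; have [] := diffM dD (dV b).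
  have [dc _] := diff_cst (-1) t.
  have [dcS _] := diffM dc dS.
  have [dN _] := diffD dU dcS.
  have [dV0 _] := jV (midx0 d p) t ltac:(by rewrite mdeg0) Tt.
  by have [] := diffM dN (differentiableV dV0 (V0 t Tt)).
split => // i.
have dDall b : mle b a -> differentiable (D b) t.
  by move=> ba; have [->//|nba] := eqVneq b a; have [|_ []//] := dDb b; rewrite ba.
have [b ba|dS pS] := @diff_sum _ (fun b : midx d p => mle b a) (fun b => (mbinom a b)%:R)
    (fun b t => D b t * V (msub a b) t) t.
  by have [] := diffM (dDall b ba) (dV b).
have := pS i; rewrite (eq_partial_on (DV a) i Tt) (jU _ _ ap Tt).2 -(DV _ _ Tt).
rewrite -(@pascal_sum _ _ _ (fun b c => D b t * V c t))//.
rewrite (bigD1 a) ?mle_refl//= [in RHS](bigD1 a) ?mle_refl//=.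
rewrite [X in _ + X](eq_bigr (fun b => (mbinom a b)%:R *
    partial i (fun t => D b t * V (msub a b) t) t)); last first.
  move=> b ba; have [bp [dD pD]] := dDb b ba.
  have [_ ->] := diffM dD (dV b); rewrite pD (jV _ _ (msub_lt b ap) Tt).2//.
move/addIr; have [_ ->] := diffM dDa (dV a).
rewrite mbinomn !mul1r (jV _ _ (msub_lt a ap) Tt).2 => /addIr.
by rewrite msubn => /(mulIf (V0 _ Tt)).
Qed.

End Jets.

(** * Differentiation under the integral sign *)

Section UnderIntegral.
Context (disp : measure_display) (T : measurableType disp) (R : realType).
Variables (k : {measure set T -> \bar R}) (A : set T).
Hypothesis mA : measurable A.

Lemma dominated_integrable_fun (f G : T -> R) : measurable_fun A f ->
  k.-integrable A (EFin \o G) -> (forall x, A x -> `|f x| <= G x) ->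
  k.-integrable A (EFin \o f).
Proof.
move=> mf iG fG; apply: le_integrable iG => //; first exact/measurable_EFinP.
by move=> x Ax /=; rewrite lee_fin (le_trans (fG x Ax))// ler_norm.
Qed.

Lemma dominated_cvg_Rintegral (f_ : nat -> T -> R) (f G : T -> R) :
  (forall n, measurable_fun A (f_ n)) -> measurable_fun A f ->
  (forall x, A x -> f_ ^~ x @ \oo --> f x) ->
  k.-integrable A (EFin \o G) -> (forall n x, A x -> `|f_ n x| <= G x) ->
  \int[k]_(x in A) f_ n x @[n --> \oo] --> \int[k]_(x in A) f x.
Proof.
move=> mf_ mf ff iG fG.
have ef x : A x -> (EFin \o f_ n) x @[n --> \oo] --> (EFin \o f) x.
  by move=> Ax; apply: cvg_EFin; [exact: nearW|exact: ff].
have [] := @dominated_convergence _ T R k A mA (fun n => EFin \o f_ n) (EFin \o f)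
  (EFin \o G).
- by move=> n; exact/measurable_EFinP.
- exact/measurable_EFinP.
- exact: aeW.
- exact: iG.
- by apply: aeW => x n Ax; rewrite lee_fin fG.
move=> if_ _ cf; apply: fine_cvg; rewrite fineK//.
exact: integrable_fin_num.
Qed.

Lemma integrable_Rsum (I : Type) (s : seq I) (P : pred I) (F : I -> T -> R) :
  (forall i, P i -> k.-integrable A (EFin \o F i)) ->
  k.-integrable A (EFin \o (fun x => \sum_(i <- s | P i) F i x)).
Proof.
move=> iF; have := integrable_sum mA s iF.
by apply: eq_integrable => // x _ /=; rewrite sumEFin.
Qed.

Lemma Rintegral_sum (I : Type) (s : seq I) (P : pred I) (F : I -> T -> R) :
  (forall i, P i -> k.-integrable A (EFin \o F i)) ->
  \int[k]_(x in A) (\sum_(i <- s | P i) F i x) =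
    \sum_(i <- s | P i) \int[k]_(x in A) F i x.
Proof.
move=> iF; elim: s => [|i s IH].
  rewrite big_nil; under eq_Rintegral do rewrite big_nil.
  by rewrite Rintegral_cst// mul0r.
rewrite big_cons; under eq_Rintegral do rewrite big_cons.
have [Pi|Pi] := boolP (P i); last exact: IH.
by rewrite RintegralD ?IH//; [exact: iF|exact: integrable_Rsum].
Qed.

Variables (d : nat) (Theta : set 'rV[R]_d).
Hypothesis openTheta : open Theta.
Variable f : 'rV[R]_d -> T -> R.
Hypothesis mf : forall theta, Theta theta -> measurable_fun A (f theta).

(** A partial derivative is the pointwise limit of difference quotients along a
    sequence, hence measurable in the parameter [x] as soon as the function is. *)
Lemma measurable_partial (i : 'I_d) theta : Theta theta ->
  (forall x, A x -> differentiable (f^~ x) theta) ->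
  measurable_fun A (fun x => partial i (f^~ x) theta).
Proof.
move=> Tt df.
have /nbhs_ballP[r /= r0 rT] : nbhs theta Theta by exact: open_nbhs_nbhs.
pose t n : R := r / 2 / n.+1%:R.
have t0 n : 0 < t n by rewrite !divr_gt0.
have tr n : t n < r.
  rewrite /t -mulrA gtr_pMr//.
  rewrite -invfM invf_lt1 ?mulr_gt0//.
  by rewrite (@lt_le_trans _ _ 2)// ?ltr1n// ler_peMr// ler1n.
have tT n : Theta (t n *: delta_mx 0 i + theta).
  apply: rT; rewrite -ball_normE/= opprD addrCA subrr addr0 normrN normrZ.
  rewrite (gtr0_norm (t0 n)) (le_lt_trans _ (tr n))//.
  by rewrite ler_piMr// ?norm_delta_le// ltW.
apply: (@measurable_fun_cvg _ _ _ _
  (fun n x => (t n)^-1 * (f (t n *: delta_mx 0 i + theta) x - f theta x))).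
  move=> n; apply: measurable_funM; first exact: measurable_cst.
  by apply: measurable_funB; apply: mf.
move=> x Ax.
have tc : t n @[n --> \oo] --> (0 : R).
  by rewrite -(mulr0 (r / 2)); apply: cvgMr; exact: cvg_harmonic.
apply/cvgrPdist_le => e e0.
have /nbhs_ballP[s /= s0 Hs] := diff_expansion (df x Ax) e0.
move/cvgrPdist_lt : tc => /(_ s s0); apply: filterS => n.
rewrite sub0r normrN => tns.
have tn := t0 n.
have nt : `|t n *: delta_mx 0 i : 'rV[R]_d| <= t n.
  by rewrite normrZ (gtr0_norm tn) ler_piMr ?norm_delta_le// ltW.
have Hb : ball (0 : 'rV[R]_d) s (t n *: delta_mx 0 i).
  rewrite -ball_normE/= sub0r normrN.
  by rewrite (le_lt_trans nt)// -(gtr0_norm tn).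
have /= Hn := Hs _ Hb.
rewrite (sum_coord_delta (fun j => partial j (f^~ x) theta)) in Hn.
rewrite -(ler_pM2r tn) -[X in _ * X <= _](gtr0_norm tn) -normrM mulrBl mulrAC.
rewrite mulVf ?gt_eqF// mul1r distrC (le_trans Hn)// ler_wpM2l//.
exact: ltW.
Qed.

(** The mean value theorem on a segment: bounds on the partial derivatives control
    the increments. *)
Lemma increment_bound (C : R) theta h x : A x ->
  (forall s, 0 <= s <= 1 -> differentiable (f^~ x) (theta + s *: h)) ->
  (forall s i, 0 <= s <= 1 -> `|partial i (f^~ x) (theta + s *: h)| <= C) ->
  `|f (h + theta) x - f theta x| <= d%:R * C * `|h|.
Proof.
move=> Ax df pC; have [s /andP[s0 s1]] := mean_value_line ltr01 df.
have hs : 0 <= s <= 1 by rewrite !ltW.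
rewrite scale1r mulr1 [h + _]addrC => ->; rewrite (derive_sum_partial _ (df s hs)).
rewrite (le_trans (ler_norm_sum _ _ _))//.
rewrite (_ : d%:R * C * `|h| = \sum_(i < d) (C * `|h|)); last first.
  by rewrite sumr_const card_ord -[RHS]mulr_natl mulrA.
apply: ler_sum => i _; rewrite normrM ler_pM//; first exact: pC.
exact: norm_coord_le.
Qed.

Variables (G : T -> R) (theta : 'rV[R]_d).
Hypothesis Tt : Theta theta.
Hypothesis df : forall x t, A x -> Theta t -> differentiable (f^~ x) t.
Hypothesis iG : k.-integrable A (EFin \o G).
Hypothesis fG : forall t x, Theta t -> A x -> `|f t x| <= G x.
Hypothesis pG : forall t x i, Theta t -> A x -> `|partial i (f^~ x) t| <= G x.

Let iF t : Theta t -> k.-integrable A (EFin \o f t).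
Proof.
by move=> ?; apply: dominated_integrable_fun iG _; [exact: mf|move=> x; exact: fG].
Qed.

Let ip i : k.-integrable A (EFin \o (fun x => partial i (f^~ x) theta)).
Proof.
apply: dominated_integrable_fun iG _ => [|x Ax]; last exact: pG.
by apply: measurable_partial => // x Ax; exact: df.
Qed.

(** The integral of a dominated family is Frechet differentiable. The remainders of
    the first-order expansions, divided by the norm of the increment, tend to zero
    pointwise and are dominated thanks to [increment_bound], so that dominated
    convergence applies. As it is a statement on sequences, a failure of
    differentiability is first turned into a sequence [h] of increments. *)
Lemma diff_under_integral :
  differentiable (fun t => \int[k]_(x in A) f t x) theta /\
  forall i, partial i (fun t => \int[k]_(x in A) f t x) theta =
    \int[k]_(x in A) partial i (f^~ x) theta.
Proof.
apply: diff_of_expansion => e e0; apply: contrapT => H.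
have /nbhs_ballP[r /= r0 rT] : nbhs theta Theta by exact: open_nbhs_nbhs.
pose F t := \int[k]_(x in A) f t x.
pose c i := \int[k]_(x in A) partial i (f^~ x) theta.
have /choice[h Hh] (n : nat) : exists h : 'rV[R]_d, `|h| < r / n.+1%:R /\
    ~ (`|F (h + theta) - F theta - \sum_i c i * h 0 i| <= e * `|h|).
  apply: contrapT => /forallNP Hn; apply: H; apply/nbhs_ballP.
  exists (r / n.+1%:R) => /=; first by rewrite divr_gt0.
  move=> h; rewrite -ball_normE/= sub0r normrN => hr.
  by apply: contrapT => nh; exact: (Hn h).
have hr n : `|h n| < r.
  rewrite (lt_le_trans (Hh n).1)// ler_pdivrMr// ler_peMr ?ler1n//.
  exact: ltW.
have hT n s : 0 <= s <= 1 -> Theta (theta + s *: h n).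
  move=> /andP[s0 s1]; apply: rT; rewrite -ball_normE/= opprD addNKr normrN normrZ.
  by rewrite (ger0_norm s0) (le_lt_trans _ (hr n))// ler_piMl.
have hT1 n : Theta (h n + theta).
  by rewrite addrC -[h n]scale1r; apply: hT; rewrite ler01 lexx.
have h0 n : 0 < `|h n|.
  rewrite lt0r normr_ge0 andbT; apply/eqP => /normr0P/eqP hn0.
  apply: (Hh n).2; rewrite hn0 add0r subrr normr0 mulr0 sub0r normrN.
  by rewrite big1 ?normr0// => i _; rewrite mxE mulr0.
have hc : h n @[n --> \oo] --> (0 : 'rV[R]_d).
  apply/cvgrPdist_lt => s s0.
  have : (r * harmonic n) @[n --> \oo] --> r * 0 by apply: cvgMr; exact: cvg_harmonic.
  rewrite mulr0 => /cvgrPdist_lt/(_ s s0); apply: filterS => n.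
  rewrite !sub0r !normrN => Hs; rewrite (lt_trans (Hh n).1)//.
  by rewrite (le_lt_trans _ Hs)// ler_norm.
pose q n x := (f (h n + theta) x - f theta x
  - \sum_i partial i (f^~ x) theta * h n 0 i) * `|h n|^-1.
have mp i : measurable_fun A (fun x => partial i (f^~ x) theta).
  by have /measurable_int/measurable_EFinP := ip i.
have mq n : measurable_fun A (q n).
  apply: measurable_funM; last exact: measurable_cst.
  apply: measurable_funB; first by apply: measurable_funB; exact: mf.
  apply: measurable_sum => i; apply: measurable_funM => //.
have qc x : A x -> q n x @[n --> \oo] --> 0.
  move=> Ax; apply/cvgrPdist_le => s s0.
  have [N _ HN] := hc _ (diff_expansion (df Ax Tt) s0).
  exists N => // n /HN /= Hn.
  by rewrite sub0r normrN /q normrM normfV normr_id ler_pdivrMr.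
have qG n x : A x -> `|q n x| <= 2 * d%:R * G x.
  move=> Ax; rewrite /q normrM normfV normr_id ler_pdivrMr//.
  rewrite (le_trans (ler_normB _ _))//.
  rewrite (_ : 2 * _ * _ * _ = d%:R * G x * `|h n| + d%:R * G x * `|h n|); last by ring.
  apply: lerD.
    apply: (increment_bound Ax) => [s /(hT n) Ts|s i /(hT n) Ts].
      exact: (df Ax Ts).
    exact: pG.
  rewrite (le_trans (ler_norm_sum _ _ _))//.
  rewrite (_ : d%:R * G x * `|h n| = \sum_(i < d) (G x * `|h n|)); last first.
    by rewrite sumr_const card_ord -[RHS]mulr_natl mulrA.
  apply: ler_sum => i _; rewrite normrM ler_pM//; first exact: pG.
  exact: norm_coord_le.
have iG2 : k.-integrable A (EFin \o (fun x => 2 * d%:R * G x)).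
  have := integrableZl mA (2 * d%:R) iG.
  by apply: eq_integrable => // x _ /=; rewrite EFinM.
have : \int[k]_(x in A) q n x @[n --> \oo] --> \int[k]_(x in A) 0.
  exact: dominated_cvg_Rintegral qc iG2 qG.
rewrite Rintegral_cst// mul0r => /cvgrPdist_lt/(_ e e0)[N _ /(_ N (leqnn N))] /=.
rewrite sub0r normrN.
suff -> : \int[k]_(x in A) q N x =
    (F (h N + theta) - F theta - \sum_i c i * h N 0 i) * `|h N|^-1.
  rewrite normrM normfV normr_id ltr_pdivrMr// => /ltW; exact: (Hh N).2.
have iph i : k.-integrable A (EFin \o (fun x => partial i (f^~ x) theta * h N 0 i)).
  have := integrableZr mA (h N 0 i) (ip i).
  by apply: eq_integrable => // x _ /=; rewrite EFinM.
have isum : k.-integrable A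
    (EFin \o (fun x => \sum_i partial i (f^~ x) theta * h N 0 i)).
  exact: integrable_Rsum.
have iB : k.-integrable A (EFin \o (fun x => f (h N + theta) x - f theta x)).
  by have := integrableB mA (iF (hT1 N)) (iF Tt); apply: eq_integrable.
rewrite /q RintegralZr//; last first.
  by have := integrableB mA iB isum; apply: eq_integrable.
rewrite RintegralB// RintegralB//; [|exact: iF|exact: iF].
congr ((_ - _ - _) * _).
rewrite Rintegral_sum//; apply: eq_bigr => i _; exact: RintegralZr.
Qed.

End UnderIntegral.

(** * Integrals with respect to signed measures *)

Section ChargeIntegral.
Context (disp : measure_display) (T : measurableType disp) (R : realType).
Variables (X : set T) (mX : measurable X).

Lemma integrable_cst_fin (m : {measure set T -> \bar R}) (c : R) :
  (m X < +oo)%E -> m.-integrable X (EFin \o (fun=> c)).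
Proof.
move=> mfin; apply: measurable_bounded_integrable => //.
by exists `|c|; split; [exact: num_real|move=> M cM x _; exact: ltW].
Qed.

Lemma bounded_integrable (m : {measure set T -> \bar R}) (f : T -> R) (M : R) :
  (m X < +oo)%E -> measurable_fun X f -> (forall x, X x -> `|f x| <= M) ->
  m.-integrable X (EFin \o f).
Proof.
move=> mfin mf fM.
exact: (dominated_integrable_fun mX mf (integrable_cst_fin M mfin)).
Qed.

Lemma bounded_mul_integrable (m : {measure set T -> \bar R}) (f D : T -> R) (M : R) :
  measurable_fun X f -> (forall x, X x -> `|f x| <= M) ->
  m.-integrable X (EFin \o D) -> m.-integrable X (EFin \o (fun x => f x * D x)).
Proof.
move=> mf fM iD.
apply: (dominated_integrable_fun mX (G := fun x => M * `|D x|)).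
- by apply: measurable_funM => //; have /measurable_int/measurable_EFinP := iD.
- have := integrableZl mX M (integrable_abse iD).
  by apply: eq_integrable => // x _ /=; rewrite EFinM.
- by move=> x Xx; rewrite normrM ler_wpM2r// fM.
Qed.

Import HBSimple HBNNSimple.

Variables (nu : {charge set T -> \bar R}) (k : {measure set T -> \bar R}) (D : T -> R).
Hypothesis iD : k.-integrable X (EFin \o D).
Hypothesis nuE : forall B, measurable B -> B `<=` X ->
  nu B = (\int[k]_(x in B) (D x)%:E)%E.

Section Jordan.
Variables (P N : set T) (nuPN : hahn_decomposition nu P N).

(* the functions whose integral against the charge is the one against its density *)
Let represents (h : T -> R) := Rintegral (jordan_pos nuPN) X h -
  Rintegral (jordan_neg nuPN) X h = \int[k]_(x in X) (h x * D x).

Let pos_fin : (jordan_pos nuPN X < +oo)%E.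
Proof. by rewrite -ge0_fin_numE ?measure_ge0// fin_num_measure. Qed.

Let neg_fin : (jordan_neg nuPN X < +oo)%E.
Proof. by rewrite -ge0_fin_numE ?measure_ge0// fin_num_measure. Qed.

Let represents_indic (B : set T) : measurable B -> represents \1_B.
Proof.
move=> mB; rewrite /represents /Rintegral !integral_indic//.
have mBX : measurable (B `&` X) by exact: measurableI.
rewrite -fineB ?fin_num_measure//.
have <- : nu (B `&` X) = (jordan_pos nuPN (B `&` X) - jordan_neg nuPN (B `&` X))%E.
  by rewrite (jordan_decomp nuPN mBX)/= /cadd /= cscaleN1.
rewrite nuE// -[LHS]/(\int[k]_(x in B `&` X) D x) Rintegral_mkcondl.
apply: eq_Rintegral => x _; rewrite patchE indicE.
by case: ifP; rewrite ?mul1r ?mul0r.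
Qed.

Let represents_comb (I : Type) (s : seq I) (c : I -> R) (F : I -> T -> R) (M : I -> R) :
  (forall i, measurable_fun X (F i)) -> (forall i x, X x -> `|F i x| <= M i) ->
  (forall i, represents (F i)) -> represents (fun x => \sum_(i <- s) c i * F i x).
Proof.
move=> mF FM rF; rewrite /represents.
have iF (m : {measure set T -> \bar R}) i : (m X < +oo)%E ->
    m.-integrable X (EFin \o F i).
  by move=> mfin; exact: (bounded_integrable mfin (mF i) (FM i)).
have icF (m : {measure set T -> \bar R}) i : (m X < +oo)%E ->
    m.-integrable X (EFin \o (fun x => c i * F i x)).
  move=> mfin; have := integrableZl mX (c i) (iF m i mfin).
  by apply: eq_integrable => // x _ /=; rewrite EFinM.
rewrite !Rintegral_sum//; [|by move=> i _; exact: icF..].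
transitivity (\int[k]_(x in X) \sum_(i <- s) (c i * (F i x * D x))); last first.
  by apply: eq_Rintegral => x _; rewrite mulr_suml; apply: eq_bigr => i _; rewrite mulrA.
have iFD i : k.-integrable X (EFin \o (fun x => F i x * D x)).
  exact: (bounded_mul_integrable (mF i) (FM i) iD).
rewrite Rintegral_sum//; last first.
  move=> i _; have := integrableZl mX (c i) (iFD i).
  by apply: eq_integrable => // x _ /=; rewrite EFinM.
rewrite -sumrB; apply: eq_bigr => i _.
by rewrite !RintegralZl ?iF// -mulrBr; congr (_ * _); exact: rF.
Qed.

Let represents_nnsfun (g : {nnsfun T >-> R}) : represents g.
Proof.
rewrite (_ : (g : T -> R) = fun x =>
    \sum_(y <- finmap.enum_fset (fset_set (range g))) y * \1_(g @^-1` [set y]) x).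
  apply: (@represents_comb _ _ _ _ (fun=> 1)).
  - by move=> y; exact: measurable_indic.
  - by move=> y x _; rewrite indicE; case: (_ \in _); rewrite ?normr1 ?normr0.
  - by move=> y; exact: represents_indic.
by apply/funext => x; rewrite fimfunE fsbig_finite.
Qed.

Let represents_ge0 (h : T -> R) (M : R) : measurable_fun X h ->
  (forall x, X x -> 0 <= h x <= M) -> represents h.
Proof.
move=> mh hM.
have mEh : measurable_fun X (EFin \o h) by exact/measurable_EFinP.
have h0 x : X x -> (0 <= (EFin \o h) x)%E by move=> /hM/andP[]; rewrite lee_fin.
pose g n := nnsfun_approx mX mEh n.
have gc x : X x -> g n x @[n --> \oo] --> h x.
  move=> Xx; have := cvg_nnsfun_approx mX mEh h0 Xx.
  by move=> /fine_cvgP[].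
have gM n x : X x -> `|g n x| <= M.
  move=> Xx; rewrite ger0_norm//; have /andP[_] := hM x Xx; apply: le_trans.
  rewrite -(cvg_lim _ (gc x Xx))//; apply: nondecreasing_cvgn_le.
    by move=> a b ab; have /lefP := nd_nnsfun_approx mX mEh ab; exact.
  by apply/cvg_ex; exists (h x); exact: gc.
have mg n : measurable_fun X (g n) by exact: measurable_funTS.
have C (m : {measure set T -> \bar R}) : (m X < +oo)%E ->
    Rintegral m X (g n) @[n --> \oo] --> Rintegral m X h.
  move=> mfin; apply: (dominated_cvg_Rintegral mX mg mh gc (integrable_cst_fin M mfin)).
  by move=> n x; exact: gM.
have mD : measurable_fun X D by have /measurable_int/measurable_EFinP := iD.
have CD : \int[k]_(x in X) (g n x * D x) @[n --> \oo] --> \int[k]_(x in X) (h x * D x).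
  apply: (dominated_cvg_Rintegral mX (G := fun x => M * `|D x|)).
  - by move=> n; exact: measurable_funM.
  - exact: measurable_funM.
  - by move=> x Xx; apply: cvgM; [exact: gc|exact: cvg_cst].
  - have := integrableZl mX M (integrable_abse iD).
    by apply: eq_integrable => // x _ /=; rewrite EFinM.
  - by move=> n x Xx; rewrite normrM ler_wpM2r// gM.
have CB : Rintegral (jordan_pos nuPN) X (g n) - Rintegral (jordan_neg nuPN) X (g n)
    @[n --> \oo] --> Rintegral (jordan_pos nuPN) X h - Rintegral (jordan_neg nuPN) X h.
  by apply: cvgB; exact: C.
have E : (fun n => Rintegral (jordan_pos nuPN) X (g n) -
    Rintegral (jordan_neg nuPN) X (g n)) = (fun n => \int[k]_(x in X) (g n x * D x)).
  by apply/funext => n; exact: represents_nnsfun.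
rewrite E in CB; exact: (cvg_unique _ CB CD).
Qed.

Lemma jordan_integral (h : T -> R) (M : R) : measurable_fun X h ->
  (forall x, X x -> `|h x| <= M) -> represents h.
Proof.
move=> mh hM.
(* [h] is the difference of the nonnegative functions [h + M] and [M] *)
have -> : h = fun x => \sum_(b <- [:: true; false])
    (if b then 1 else -1) * (if b then h x + M else M).
  by apply/funext => x; rewrite !big_cons big_nil; ring.
apply: (@represents_comb bool _ (fun b => if b then 1 else -1)
  (fun b x => if b then h x + M else M) (fun=> M + M)).
- by case => //; apply: measurable_funD.
- move=> b x Xx; have := hM x Xx; rewrite ler_norml => /andP[h1 h2].
  by case: b; rewrite ler_norml; lra.
- case; apply: (@represents_ge0 _ (M + M)).
  + exact: measurable_funD.
  + by move=> x Xx; have := hM x Xx; rewrite ler_norml => /andP[h1 h2]; lra.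
  + exact: measurable_cst.
  + by move=> x Xx; have := hM x Xx; have := normr_ge0 (h x); lra.
Qed.

End Jordan.

(** Integrals with respect to a charge with density [D] with respect to [k]. The
    Jordan parts are only known through their difference, so the formula is proved
    for that difference: on indicators it is the decomposition of the charge, then
    it extends to simple functions by linearity and to bounded functions by
    dominated convergence. *)
Lemma charge_Rintegral_density (h : T -> R) (M : R) : measurable_fun X h ->
  (forall x, X x -> `|h x| <= M) ->
  charge_Rintegral nu X h = \int[k]_(x in X) (h x * D x).
Proof. by move=> mh hM; exact: (jordan_integral _ mh hM). Qed.

End ChargeIntegral.

(** * Tonelli's theorem on measurable rectangles *)

(** The measures are only finite on the sides of the rectangle; restricting them to
    these sides reduces the statements to finite measures on the whole spaces. *)
Section TonelliOnRectangle.
Context (d1 d2 : measure_display) (T1 : measurableType d1) (T2 : measurableType d2)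
  (R : realType).
Variables (m1 : {measure set T1 -> \bar R}) (m2 : {measure set T2 -> \bar R}).
Variables (X1 : set T1) (X2 : set T2) (mX1 : measurable X1) (mX2 : measurable X2).
Hypotheses (fin1 : (m1 X1 < +oo)%E) (fin2 : (m2 X2 < +oo)%E).
Variable f : T1 -> T2 -> R.
Hypothesis mf : measurable_fun (X1 `*` X2) (fun z => f z.1 z.2).
Hypothesis f0 : forall x y, X1 x -> X2 y -> 0 <= f x y.

Let g := (EFin \o (fun z => f z.1 z.2)) \_ (X1 `*` X2).

Let mg : measurable_fun setT g.
Proof.
apply/measurable_restrict => //; first exact: measurableX.
by rewrite setTI; exact/measurable_EFinP.
Qed.

Let g0 z : (0 <= g z)%E.
Proof. by rewrite /g patchE; case: ifP => // /set_mem[] ? ?; rewrite lee_fin f0. Qed.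

Let r1 : {finite_measure set T1 -> \bar R} := mfrestr mX1 fin1.
Let r2 : {finite_measure set T2 -> \bar R} := mfrestr mX2 fin2.

Let int1 (h : T1 -> \bar R) : (\int[m1]_(x in X1) h x = \int[r1]_x (h \_ X1) x)%E.
Proof.
rewrite -integral_mkcond; apply: eq_measure_integral => A mA AX.
by change (m1 A = m1 (A `&` X1)); rewrite setIidl.
Qed.

Let int2 (h : T2 -> \bar R) : (\int[m2]_(x in X2) h x = \int[r2]_x (h \_ X2) x)%E.
Proof.
rewrite -integral_mkcond; apply: eq_measure_integral => A mA AX.
by change (m2 A = m2 (A `&` X2)); rewrite setIidl.
Qed.

Let inner2 x : ((fun x => \int[m2]_(y in X2) (f x y)%:E) \_ X1)%E x
  = (\int[r2]_y g (x, y))%E.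
Proof.
rewrite patchE; case: ifPn => [/set_mem Xx|xX].
  rewrite int2; apply: eq_integral => y _; rewrite /g !patchE.
  congr (if _ then _ else _); apply/idP/idP => [/set_mem Xy|/set_mem[_ Xy]].
    by apply/mem_set; split.
  exact: mem_set.
rewrite integral0_eq// => y _; rewrite /g patchE ifF//.
by apply: contraNF xX => /set_mem[Xx _]; exact: mem_set.
Qed.

Let inner1 y : ((fun y => \int[m1]_(x in X1) (f x y)%:E) \_ X2)%E y
  = (\int[r1]_x g (x, y))%E.
Proof.
rewrite patchE; case: ifPn => [/set_mem Xy|yX].
  rewrite int1; apply: eq_integral => x _; rewrite /g !patchE.
  congr (if _ then _ else _); apply/idP/idP => [/set_mem Xx|/set_mem[Xx _]].
    by apply/mem_set; split.
  exact: mem_set.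
rewrite integral0_eq// => x _; rewrite /g patchE ifF//.
by apply: contraNF yX => /set_mem[_ Xy]; exact: mem_set.
Qed.

Lemma tonelli_on : (\int[m1]_(x in X1) \int[m2]_(y in X2) (f x y)%:E =
  \int[m2]_(y in X2) \int[m1]_(x in X1) (f x y)%:E)%E.
Proof.
rewrite int1 int2 (eq_integral _ _ (fun x _ => inner2 x)).
rewrite [RHS](eq_integral _ _ (fun y _ => inner1 y)).
exact: (fubini_tonelli (m1 := r1) (m2 := r2) g mg g0).
Qed.

Lemma measurable_tonelli_on :
  measurable_fun X1 (fun x => \int[m2]_(y in X2) (f x y)%:E)%E.
Proof.
have /(measurable_funTS (D := X1)) := measurable_fun_fubini_tonelli_F (m2 := r2) g mg g0.
apply: eq_measurable_fun => x Xx; rewrite /fubini_F -inner2 patchE Xx//.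
Qed.

Lemma measurable_Rintegral_on : measurable_fun X1 (fun x => \int[m2]_(y in X2) f x y).
Proof.
by apply: (measurableT_comp (f := fine)) => //; exact: measurable_tonelli_on.
Qed.

End TonelliOnRectangle.

Lemma EFin_Rintegral (d : measure_display) (T : measurableType d) (R : realType)
    (m : {measure set T -> \bar R}) (X : set T) (h : T -> R) : measurable X ->
  m.-integrable X (EFin \o h) ->
  (\int[m]_(x in X) h x)%:E = (\int[m]_(x in X) (h x)%:E)%E.
Proof. by move=> mX ih; rewrite /Rintegral fineK//; exact: integrable_fin_num. Qed.

Lemma measurable_fun_swap_on (d1 d2 : measure_display) (T1 : measurableType d1)
  (T2 : measurableType d2) (R : realType) (X1 : set T1) (X2 : set T2)
  (f : T1 -> T2 -> R) : measurable X1 -> measurable X2 ->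
  measurable_fun (X1 `*` X2) (fun z => f z.1 z.2) ->
  measurable_fun (X2 `*` X1) (fun z => f z.2 z.1).
Proof.
move=> mX1 mX2 mf.
apply: (@measurable_comp _ _ _ _ _ _ (X1 `*` X2) (fun z => f z.1 z.2) _
  (fun z => (z.2, z.1))) => //.
- exact: measurableX.
- by move=> _ [[u v] [/= ? ?] <-].
- by apply: measurable_funTS; apply: measurable_fun_pair.
Qed.

(** Real-valued versions. A bound of product form [G1 x * G2 y] makes every section
    integrable, so that inner integrals are finite at every point. *)
Section TonelliR.
Context (d1 d2 : measure_display) (T1 : measurableType d1) (T2 : measurableType d2)
  (R : realType).
Variables (m1 : {measure set T1 -> \bar R}) (m2 : {measure set T2 -> \bar R}).
Variables (X1 : set T1) (X2 : set T2) (mX1 : measurable X1) (mX2 : measurable X2).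
Hypotheses (fin1 : (m1 X1 < +oo)%E) (fin2 : (m2 X2 < +oo)%E).
Variable f : T1 -> T2 -> R.
Hypothesis mf : measurable_fun (X1 `*` X2) (fun z => f z.1 z.2).
Hypothesis f0 : forall x y, X1 x -> X2 y -> 0 <= f x y.

Lemma measurable_section x : X1 x -> measurable_fun X2 (f x).
Proof.
move=> Xx B0 B mB.
have := measurable_xsection x (mf (measurableX mX1 mX2) mB).
congr measurable; apply/seteqP; split => y; rewrite /xsection/= inE/=.
  by move=> [[_ ?] ?].
by move=> [? ?].
Qed.

Variables (G1 : T1 -> R) (G2 : T2 -> R).
Hypothesis iG1 : m1.-integrable X1 (EFin \o G1).
Hypothesis iG2 : m2.-integrable X2 (EFin \o G2).
Hypothesis fG : forall x y, X1 x -> X2 y -> f x y <= G1 x * G2 y.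

Lemma integrable_section x : X1 x -> m2.-integrable X2 (EFin \o f x).
Proof.
move=> Xx; apply: (dominated_integrable_fun mX2 (G := fun y => G1 x * G2 y)).
- exact: measurable_section.
- have := integrableZl mX2 (G1 x) iG2.
  by apply: eq_integrable => // y _ /=; rewrite EFinM.
- by move=> y Xy; rewrite ger0_norm ?f0// fG.
Qed.

Lemma Rintegral_section_le x : X1 x ->
  0 <= \int[m2]_(y in X2) f x y <= G1 x * \int[m2]_(y in X2) G2 y.
Proof.
move=> Xx; apply/andP; split.
  by apply: Rintegral_ge0 => y Xy; exact: f0.
rewrite -RintegralZl//; apply: le_Rintegral => //.
- exact: integrable_section.
- have := integrableZl mX2 (G1 x) iG2.
  by apply: eq_integrable => // y _ /=; rewrite EFinM.
- by move=> y Xy; exact: fG.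
Qed.

Lemma integrable_Rintegral_section :
  m1.-integrable X1 (EFin \o (fun x => \int[m2]_(y in X2) f x y)).
Proof.
apply: (dominated_integrable_fun mX1 (G := fun x => G1 x * \int[m2]_(y in X2) G2 y)).
- exact: measurable_Rintegral_on.
- have := integrableZr mX1 (\int[m2]_(y in X2) G2 y) iG1.
  by apply: eq_integrable => // y _ /=; rewrite EFinM.
- by move=> x Xx; have /andP[h0 h1] := Rintegral_section_le Xx; rewrite ger0_norm.
Qed.

End TonelliR.

Lemma Rintegral_swap (d1 d2 : measure_display) (T1 : measurableType d1)
  (T2 : measurableType d2) (R : realType)
  (m1 : {measure set T1 -> \bar R}) (m2 : {measure set T2 -> \bar R})
  (X1 : set T1) (X2 : set T2) (f : T1 -> T2 -> R) (G1 : T1 -> R) (G2 : T2 -> R) :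
  measurable X1 -> measurable X2 -> (m1 X1 < +oo)%E -> (m2 X2 < +oo)%E ->
  measurable_fun (X1 `*` X2) (fun z => f z.1 z.2) ->
  (forall x y, X1 x -> X2 y -> 0 <= f x y <= G1 x * G2 y) ->
  m1.-integrable X1 (EFin \o G1) -> m2.-integrable X2 (EFin \o G2) ->
  \int[m1]_(x in X1) \int[m2]_(y in X2) f x y =
  \int[m2]_(y in X2) \int[m1]_(x in X1) f x y.
Proof.
move=> mX1 mX2 fin1 fin2 mf fG iG1 iG2.
have f0 x y : X1 x -> X2 y -> 0 <= f x y by move=> Xx Xy; have /andP[] := fG x y Xx Xy.
have f1 x y : X1 x -> X2 y -> f x y <= G1 x * G2 y.
  by move=> Xx Xy; have /andP[] := fG x y Xx Xy.
have mf' := measurable_fun_swap_on mX1 mX2 mf.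
have f0' y x : X2 y -> X1 x -> 0 <= f x y by move=> *; exact: f0.
have f1' y x : X2 y -> X1 x -> f x y <= G2 y * G1 x.
  by move=> *; rewrite mulrC; exact: f1.
have I2 x : X1 x -> m2.-integrable X2 (EFin \o f x).
  exact: (integrable_section mX1 mX2 mf f0 iG2 f1).
have I1 y : X2 y -> m1.-integrable X1 (EFin \o f^~ y).
  exact: (integrable_section mX2 mX1 mf' f0' iG1 f1').
congr fine.
rewrite (eq_integral _ _ (fun x Xx => EFin_Rintegral mX2 (I2 x (set_mem Xx)))).
rewrite [RHS](eq_integral _ _ (fun y Xy => EFin_Rintegral mX1 (I1 y (set_mem Xy)))).
exact: tonelli_on.
Qed.

(** * Dominated jets *)

Section DominatedJets.
Context (disp : measure_display) (T : measurableType disp) (R : realType) (d p : nat).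
Variables (Theta : set 'rV[R]_d) (X : set T).
Hypotheses (openTheta : open Theta) (mX : measurable X).
Implicit Types (k : {measure set T -> \bar R}) (G : T -> R)
  (D : midx d p -> 'rV[R]_d -> T -> R).

(** Jets depending on a point [x], fit for differentiation under the integral sign.
    The constant of domination may depend on the neighbourhood of [t]: uniformity
    in the parameter would be lost after division by the normalizing constant of
    the filter. Measurability is asked at order zero only, as derivatives inherit
    it. *)
Record dominated_jet k G D : Prop := DominatedJet {
  dj_ge0 : forall x, X x -> 0 <= G x;
  dj_bound : k.-integrable X (EFin \o G);
  dj_jet : forall x, X x -> jet Theta (fun a t => D a t x);
  dj_measurable0 : forall t, Theta t -> measurable_fun X (D (midx0 d p) t);
  dj_dominated : forall t, Theta t -> exists C : R, \forall s \near t,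
    forall a x, X x -> `|D a s x| <= C * G x }.

Section Theory.
Variables (k : {measure set T -> \bar R}) (G : T -> R).
Variable D : midx d p -> 'rV[R]_d -> T -> R.
Hypothesis djD : dominated_jet k G D.

Lemma dj_measurable a t : Theta t -> measurable_fun X (D a t).
Proof.
move: t; elim/midx_ind: a => [|a i ap IH] t Tt; first exact: (dj_measurable0 djD).
have dD x : X x -> differentiable (fun s => D a s x) t /\
    forall j, partial j (fun s => D a s x) t = D (mincr a j) t x.
  by move=> Xx; exact: (dj_jet djD Xx).
apply: (eq_measurable_fun (fun x => partial i (fun s => D a s x) t)).
  by move=> x /set_mem Xx; have [_ ->] := dD x Xx.
apply: (measurable_partial openTheta (f := D a) _ i Tt) => [s Ts|x Xx].
  exact: IH.
by have [] := dD x Xx.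
Qed.

Lemma dj_integrable a t : Theta t -> k.-integrable X (EFin \o D a t).
Proof.
move=> Tt; have [C /nbhs_singleton DC] := dj_dominated djD Tt.
apply: (dominated_integrable_fun mX (G := fun x => C * G x)).
- exact: dj_measurable.
- have := integrableZl mX C (dj_bound djD).
  by apply: eq_integrable => // x _ /=; rewrite EFinM.
- by move=> x Xx; exact: DC.
Qed.

Lemma jet_Rintegral (B : set T) : measurable B -> B `<=` X ->
  jet Theta (fun a t => \int[k]_(x in B) D a t x).
Proof.
move=> mB BX a t ap Tt.
have [C DC] := dj_dominated djD Tt.
pose S := [set s | Theta s /\ forall a x, X x -> `|D a s x| <= C * G x].
have SD : nbhs t S.
  have nT : nbhs t Theta by exact: open_nbhs_nbhs.
  exact: filterI nT DC.
have ST s : S^° s -> S s by exact: interior_subset.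
have dD x s : B x -> S^° s -> differentiable (fun s => D a s x) s /\
    forall j, partial j (fun s => D a s x) s = D (mincr a j) s x.
  by move=> Bx /ST[Ts _]; exact: (dj_jet djD (BX _ Bx)).
have iG : k.-integrable B (EFin \o (fun x => C * G x)).
  have := integrableZl mX C (dj_bound djD) => /(integrableS mX mB BX).
  by apply: eq_integrable => // x _ /=; rewrite EFinM.
have [|||||||df pf] := @diff_under_integral _ T R k B mB d S^° _ (D a) _
    (fun x => C * G x) t.
- exact: open_interior.
- move=> s /ST[Ts _]; exact: measurable_funS (dj_measurable a Ts).
- exact: SD.
- by move=> x s Bx Ss; have [] := dD x s Bx Ss.
- exact: iG.
- by move=> s x /ST[_ +] Bx; apply; exact: BX.
- move=> s x i Ss Bx; have [_ ->] := dD x s Bx Ss.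
  by have [_] := ST s Ss; apply; exact: BX.
split => // i; rewrite pf; apply: eq_Rintegral => x /set_mem Bx.
by have [_ ->] := dD x t Bx SD.
Qed.

End Theory.

(** A bound for each multi-index gives a common one, as multi-indices are finitely
    many. *)
Lemma dominated_all G D (t : 'rV[R]_d) : (forall x, X x -> 0 <= G x) ->
  (forall a, exists C : R, \forall s \near t, forall x, X x -> `|D a s x| <= C * G x) ->
  exists C : R, \forall s \near t, forall a x, X x -> `|D a s x| <= C * G x.
Proof.
move=> G0 /choice[C DC]; exists (\sum_a `|C a|).
have nH : \forall s \near t, forall a, forall x, X x -> `|D a s x| <= C a * G x.
  exact: (@filter_forall _ (midx d p)
    (fun a s => forall x, X x -> `|D a s x| <= C a * G x) (nbhs t) (nbhs_filter t) DC).
apply: filterS nH => s H a x Xx; rewrite (le_trans (H a x Xx))// ler_wpM2r ?G0//.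
rewrite (le_trans (ler_norm _))// (bigD1 a)//= lerDl.
by apply: sumr_ge0.
Qed.

Lemma dominated_jet_mul k G D (H : midx d p -> 'rV[R]_d -> T -> R) (K : R) :
  dominated_jet k G D ->
  (forall x, X x -> jet Theta (fun a t => H a t x)) ->
  (forall t, Theta t -> measurable_fun X (H (midx0 d p) t)) ->
  (forall a t x, Theta t -> X x -> `|H a t x| <= K) ->
  dominated_jet k G (fun a t x =>
    \sum_(b | mle b a) (mbinom a b)%:R * (D b t x * H (msub a b) t x)).
Proof.
move=> djD jH mH HK.
have iD := dj_bound djD; have G0 := dj_ge0 djD.
split => //.
- by move=> x Xx; exact: (jet_mul (dj_jet djD Xx) (jH x Xx)).
- move=> t Tt; have mDH : measurable_fun X
      (fun x => D (midx0 d p) t x * H (midx0 d p) t x).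
    by apply: measurable_funM; [exact: (dj_measurable djD _ Tt)|exact: mH].
  apply: eq_measurable_fun mDH => x _.
  by rewrite sum_mle0 mbinomn mul1r msubn.
- move=> t Tt; have [C DC] := dj_dominated djD Tt; apply: dominated_all => // a.
  exists (\sum_(b | mle b a) (mbinom a b)%:R * (C * K)).
  have nT : nbhs t Theta by exact: open_nbhs_nbhs.
  apply: filterS2 nT DC => s Ts DC x Xx.
  rewrite (le_trans (ler_norm_sum _ _ _))// mulr_suml; apply: ler_sum => b _.
  rewrite normrM ger0_norm// -!mulrA ler_wpM2l// normrM.
  by rewrite [K * _]mulrC mulrA ler_pM ?DC ?HK.
Qed.

End DominatedJets.

(** * One step of the filter *)

Section Stages.
Variables (R : realType) (d dx dy p : nat) (Theta : set 'rV[R]_d).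
Local Notation state := (borelRn R dx).
Local Notation obs := (borelRn R dy).
Variables (X : set state) (mu : {measure set state -> \bar R}).

(** What a step of the filter uses of the transition kernel for one observation.
    The bound [Phi] on all the derivatives is a function of the new state, so that
    it dominates the new density. The minorization makes the normalizing constant
    positive. *)
Record regular_kernel (pt : 'rV[R]_d -> state -> state -> R)
    (qt : 'rV[R]_d -> obs -> state -> R) (y : obs) (Phi : state -> R) : Prop :=
  RegularKernel {
  rk_diff : forall x x', X x -> X x' ->
    ntimes_differentiable p Theta (fun t => rt pt qt t y x x');
  rk_ge0 : forall t x x', Theta t -> X x -> X x' -> 0 <= rt pt qt t y x x';
  rk_measurable : forall t, Theta t ->
    measurable_fun (X `*` X) (fun z => rt pt qt t y z.1 z.2);
  rk_dominated : forall (a : midx d p) t x x', Theta t -> X x -> X x' ->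
    `|mpartial a (fun s => rt pt qt s y x x') t| <= Phi x;
  rk_bound_ge0 : forall x, X x -> 0 <= Phi x;
  rk_bound_integrable : mu.-integrable X (EFin \o Phi);
  rk_minorized : forall t, Theta t -> exists2 c : R, 0 < c &
    forall x', X x' -> c <= \int[mu]_(x in X) rt pt qt t y x x' }.

(** The invariant of the induction over time: [D] consists of a density with
    respect to [k] and its derivatives in the parameter, and [L] is the vector
    measure with densities [D]. The reference measure [k] is a parameter since it
    is the initial distribution at the start and [mu] afterwards. *)
Record filter_stage (k : {measure set state -> \bar R}) (G : state -> R)
    (D : midx d p -> 'rV[R]_d -> state -> R) (L : 'rV[R]_d -> vmeasure R d dx p) :
    Prop := FilterStage {
  fs_finite : (k X < +oo)%E;
  fs_jet : dominated_jet Theta X k G D;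
  fs_ge0 : forall t x, Theta t -> X x -> 0 <= D (midx0 d p) t x;
  fs_mass : forall t, Theta t -> \int[k]_(x in X) D (midx0 d p) t x = 1;
  fs_charge : forall a t B, Theta t -> measurable B -> B `<=` X ->
    L t a B = (\int[k]_(x in B) (D a t x)%:E)%E }.

End Stages.

(** [E] contains the derivatives of the integrand [r g] of one step, [U] those of
    the unnormalized new density [u], [V] those of the normalizing constant, and
    [W] those of the new density, obtained as a quotient. *)
Section FilterStep.
Variables (R : realType) (d dx dy p : nat) (Theta : set 'rV[R]_d).
Hypotheses (openTheta : open Theta) (p_gt0 : (0 < p)%N).
Local Notation state := (borelRn R dx).
Local Notation obs := (borelRn R dy).
Variables (X : set state) (mX : measurable X) (mu : {measure set state -> \bar R}).
Hypothesis muX : (mu X < +oo)%E.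
Variables (pt : 'rV[R]_d -> state -> state -> R) (qt : 'rV[R]_d -> obs -> state -> R).
Variables (y : obs) (Phi : state -> R).
Hypothesis reg : regular_kernel p Theta X mu pt qt y Phi.
Variables (k : {measure set state -> \bar R}) (G : state -> R)
  (D : midx d p -> 'rV[R]_d -> state -> R) (L : 'rV[R]_d -> vmeasure R d dx p).
Hypothesis stage : filter_stage Theta X k G D L.

Local Notation r t x x' := (rt pt qt t y x x').
Local Notation zero := (midx0 d p).
Let Dr (a : midx d p) t x x' := mpartial a (fun s => r s x x') t.

Let r_diff := rk_diff reg.
Let r_ge0 := rk_ge0 reg.
Let r_meas := rk_measurable reg.
Let Dr_bound := rk_dominated reg.
Let Phi_ge0 := rk_bound_ge0 reg.
Let iPhi := rk_bound_integrable reg.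
Let r_low := rk_minorized reg.
Let kX := fs_finite stage.
Let djD := fs_jet stage.
Let D_ge0 := fs_ge0 stage.
Let D_mass := fs_mass stage.
Let LE := fs_charge stage.

Let Dr0 t x x' : Dr zero t x x' = r t x x'.
Proof. by rewrite /Dr mpartial_id. Qed.

Let r_le t x x' : Theta t -> X x -> X x' -> r t x x' <= Phi x.
Proof.
move=> Tt Xx Xx'; have := Dr_bound zero Tt Xx Xx'; rewrite -/(Dr _ _ _ _) Dr0.
exact: le_trans (ler_norm _).
Qed.

Let E x a t x' :=
  \sum_(b | mle b a) (mbinom a b)%:R * (D b t x' * Dr (msub a b) t x x').

Let jetDr x x' : X x -> X x' -> jet Theta (fun a t => Dr a t x x').
Proof. by move=> Xx Xx'; exact: (jet_mpartial openTheta (r_diff Xx Xx')). Qed.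

Let mDr0 x t : X x -> Theta t -> measurable_fun X (Dr zero t x).
Proof.
move=> Xx Tt; have := measurable_section mX mX (r_meas Tt) Xx.
by apply: eq_measurable_fun => x' _; rewrite Dr0.
Qed.

Let djE x : X x -> dominated_jet Theta X k G (E x).
Proof.
move=> Xx; apply: (dominated_jet_mul openTheta (H := fun a t x' => Dr a t x x') (K := Phi x) djD).
- by move=> x' Xx'; exact: jetDr.
- by move=> t Tt; exact: mDr0.
- by move=> a t x' Tt Xx'; exact: Dr_bound.
Qed.

Let mDr a x t : X x -> Theta t -> measurable_fun X (Dr a t x).
Proof.
move=> Xx Tt.
suff dj : dominated_jet Theta X k (fun=> Phi x) (fun a t x' => Dr a t x x').
  exact: (dj_measurable openTheta dj).
split.
- by move=> x' Xx'; exact: Phi_ge0.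
- exact: integrable_cst_fin.
- by move=> x' Xx'; exact: jetDr.
- by move=> s Ts; exact: mDr0.
- move=> s Ts; exists 1; have nT : nbhs s Theta by exact: open_nbhs_nbhs.
  by apply: filterS nT => u Tu b x' Xx'; rewrite mul1r Dr_bound.
Qed.

Let U a t x := \int[k]_(x' in X) E x a t x'.

Let iDDr a b t x : Theta t -> X x ->
  k.-integrable X (EFin \o (fun x' => Dr a t x x' * D b t x')).
Proof.
move=> Tt Xx; apply: (bounded_mul_integrable mX (M := Phi x)).
- exact: mDr.
- by move=> x' Xx'; exact: Dr_bound.
- exact: (dj_integrable openTheta mX djD).
Qed.

Let UE a t x : Theta t -> X x -> U a t x =
  \sum_(b | mle b a) (mbinom a b)%:R *
    \int[k]_(x' in X) (Dr (msub a b) t x x' * D b t x').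
Proof.
move=> Tt Xx; rewrite /U /E Rintegral_sum//; last first.
  move=> b _; have := integrableZl mX (mbinom a b)%:R (iDDr (msub a b) b Tt Xx).
  apply: eq_integrable => // x' _ /=.
  by rewrite -EFinM [D _ _ _ * _]mulrC.
apply: eq_bigr => b _; under eq_Rintegral do rewrite [D _ _ _ * _]mulrC.
by rewrite RintegralZl//; exact: iDDr.
Qed.

Let U0E t x : Theta t -> X x ->
  U zero t x = \int[k]_(x' in X) (r t x x' * D zero t x').
Proof.
move=> Tt Xx; rewrite UE// sum_mle0 mbinomn mul1r msubn.
by apply: eq_Rintegral => x' _; rewrite Dr0.
Qed.

Let mrD t : Theta t ->
  measurable_fun (X `*` X) (fun z => r t z.1 z.2 * D zero t z.2).
Proof.
move=> Tt; apply: measurable_funM; first exact: r_meas.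
apply: (@measurable_comp _ _ _ _ _ _ X (D zero t) _ snd) => //.
- by move=> _ [[u v] [/= ? ?] <-].
- exact: (dj_measurable openTheta djD).
- exact: measurable_funTS.
Qed.

Let rD_ge0 t x x' : Theta t -> X x -> X x' -> 0 <= r t x x' * D zero t x'.
Proof. by move=> Tt Xx Xx'; rewrite mulr_ge0// ?r_ge0// D_ge0. Qed.

Let rD_le t x x' : Theta t -> X x -> X x' ->
  r t x x' * D zero t x' <= Phi x * D zero t x'.
Proof. by move=> Tt Xx Xx'; rewrite ler_wpM2r// ?r_le// D_ge0. Qed.

Let djU : dominated_jet Theta X mu Phi U.
Proof.
split => //.
- move=> x Xx; have := jet_Rintegral openTheta mX (djE Xx) mX.
  exact.
- move=> t Tt.
  have := measurable_Rintegral_on mX mX kX (mrD Tt)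
    (fun x x' Xx Xx' => rD_ge0 Tt Xx Xx').
  by apply: eq_measurable_fun => x /set_mem Xx; rewrite U0E.
- move=> t Tt; have [C DC] := dj_dominated djD Tt; apply: dominated_all => // a.
  exists (\sum_(b | mle b a) (mbinom a b)%:R * (C * \int[k]_(x' in X) G x')).
  have nT : nbhs t Theta by exact: open_nbhs_nbhs.
  apply: filterS2 nT DC => s Ts DC x Xx.
  rewrite UE// (le_trans (ler_norm_sum _ _ _))// mulr_suml; apply: ler_sum => b _.
  rewrite normrM ger0_norm// -!mulrA ler_wpM2l//.
  have iCG : k.-integrable X (EFin \o (fun x' => Phi x * C * G x')).
    have := integrableZl mX (Phi x * C) (dj_bound djD).
    by apply: eq_integrable => // x' _ /=; rewrite EFinM.
  rewrite (le_trans (le_normr_Rintegral mX (iDDr _ _ Ts Xx)))//.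
  rewrite [_ * Phi x]mulrC mulrA [C * Phi x]mulrC -RintegralZl//; last exact: (dj_bound djD).
  apply: le_Rintegral => //.
    by have := integrable_abse (iDDr (msub a b) b Ts Xx); apply: eq_integrable.
  move=> x' Xx'; rewrite normrM -mulrA ler_pM//; first exact: Dr_bound.
  exact: DC.
Qed.

Let V a t := \int[mu]_(x in X) U a t x.

Let jetV : jet Theta V.
Proof. by have := jet_Rintegral openTheta mX djU mX; exact. Qed.

(* exchanging the integrals, the constant is an average of kernel masses *)
Let V0_gt0 t : Theta t -> 0 < V zero t.
Proof.
move=> Tt; have [c c0 Hc] := r_low Tt.
have iD : k.-integrable X (EFin \o D zero t) by exact: (dj_integrable openTheta mX djD).
have f_ge0 x' x : X x' -> X x -> 0 <= r t x x' * D zero t x'.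
  by move=> ? ?; exact: rD_ge0.
have f_le x' x : X x' -> X x -> r t x x' * D zero t x' <= D zero t x' * Phi x.
  by move=> ? ?; rewrite [D _ _ _ * Phi _]mulrC; exact: rD_le.
have mf' := measurable_fun_swap_on (f := fun x x' => r t x x' * D zero t x') mX mX (mrD Tt).
have -> : V zero t = \int[k]_(x' in X) \int[mu]_(x in X) (r t x x' * D zero t x').
  transitivity (\int[mu]_(x in X) \int[k]_(x' in X) (r t x x' * D zero t x')).
    by apply: eq_Rintegral => x /set_mem Xx; rewrite U0E.
  apply: (Rintegral_swap (f := fun x x' => r t x x' * D zero t x') mX mX muX kX
    (mrD Tt) (G1 := Phi) (G2 := D zero t)) => //.
  by move=> x x' Xx Xx'; rewrite rD_ge0// rD_le.
apply: (lt_le_trans c0); rewrite -[leLHS]mulr1 -(D_mass Tt) -RintegralZl//.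
apply: le_Rintegral => //.
- have := integrableZl mX c iD.
  by apply: eq_integrable => // x' _ /=; rewrite EFinM.
- exact: (integrable_Rintegral_section (f := fun x' x => r t x x' * D zero t x')
    mX mX muX mf' f_ge0 iD iPhi f_le).
- move=> x' Xx'; rewrite RintegralZr//.
    by rewrite ler_wpM2r ?D_ge0// Hc.
  apply: (dominated_integrable_fun mX _ iPhi) => [|x Xx].
    exact: (measurable_section (f := fun x' x => r t x x') mX mX
      (measurable_fun_swap_on (f := fun x x' => r t x x') mX mX (r_meas Tt)) Xx').
  by rewrite ger0_norm ?r_ge0// r_le.
Qed.

Let rderE a b t x : Theta t -> X x ->
  rder X pt qt t y a x (L t b) = \int[k]_(x' in X) (Dr a t x x' * D b t x').
Proof.
move=> Tt Xx; have iD : k.-integrable X (EFin \o D b t) by exact: (dj_integrable openTheta mX djD).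
apply: (charge_Rintegral_density mX iD (fun B mB BX => LE b Tt mB BX) (mDr a Xx Tt)).
by move=> x' Xx'; exact: Dr_bound.
Qed.

Let sderE a t x : Theta t -> X x ->
  sder X mu pt qt t y a x (L t) = U a t x / V zero t.
Proof.
move=> Tt Xx; rewrite UE// mulr_suml; apply: eq_bigr => b _.
rewrite rderE// -mulrA; congr (_ * (_ / _)).
apply: eq_Rintegral => x' /set_mem Xx'; rewrite rderE// U0E//.
by apply: eq_Rintegral => x'' _; rewrite Dr0.
Qed.

Let int_sderE a t : Theta t ->
  \int[mu]_(x in X) sder X mu pt qt t y a x (L t) = V a t / V zero t.
Proof.
move=> Tt; rewrite -RintegralZr//; last exact: (dj_integrable openTheta mX djU).
by apply: eq_Rintegral => x /set_mem Xx; rewrite sderE.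
Qed.

Let W a t x := fder X mu pt qt t y a x (L t).

Let WE a t x : Theta t -> X x -> W a t x = (U a t x -
  \sum_(b | mle b a && (b != a)) (mbinom a b)%:R * (W b t x * V (msub a b) t)) / V zero t.
Proof.
move=> Tt Xx; rewrite {1}/W fderE sderE// mulrBl; congr (_ - _).
rewrite mulr_suml; apply: eq_bigr => b _.
by rewrite int_sderE// !mulrA.
Qed.

(* the recursion defining [fder] is the Leibniz rule for [u = w v], solved for [w] *)
Let WV a t x : Theta t -> X x ->
  \sum_(b | mle b a) (mbinom a b)%:R * (W b t x * V (msub a b) t) = U a t x.
Proof.
move=> Tt Xx; rewrite (bigD1 a) ?mle_refl//= mbinomn msubn mul1r WE//.
by rewrite divfK ?subrK// gt_eqF// V0_gt0.
Qed.

Lemma filter_step_density0 t x : Theta t -> X x ->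
  fder X mu pt qt t y zero x (L t) = (\int[k]_(x' in X) (r t x x' * D zero t x')) /
    \int[mu]_(x'' in X) \int[k]_(x' in X) (r t x'' x' * D zero t x').
Proof.
move=> Tt Xx; rewrite fder0 (sderE zero Tt Xx) (U0E Tt Xx); congr (_ / _).
by apply: eq_Rintegral => x'' /set_mem Xx''; rewrite U0E.
Qed.

Let W0E t x : Theta t -> X x -> W zero t x = U zero t x / V zero t.
Proof. by move=> Tt Xx; rewrite /W fder0 sderE. Qed.

Let W_ge0 t x : Theta t -> X x -> 0 <= W zero t x.
Proof.
move=> Tt Xx; rewrite W0E// divr_ge0//; last by rewrite ltW ?V0_gt0.
by rewrite U0E//; apply: Rintegral_ge0 => x' Xx'; exact: rD_ge0.
Qed.

Let W_mass t : Theta t -> \int[mu]_(x in X) W zero t x = 1.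
Proof.
move=> Tt; rewrite /W; under eq_Rintegral do rewrite fder0.
by rewrite int_sderE// divff// gt_eqF// V0_gt0.
Qed.

(* The equation for [W a] bounds it by the [W b] of smaller degree, since [V 0] is
   continuous in the parameter and therefore locally bounded away from zero. *)
Let W_dominated t a : Theta t -> exists C : R, \forall s \near t,
  forall x, X x -> `|W a s x| <= C * Phi x.
Proof.
move=> Tt; have nT : nbhs t Theta by exact: open_nbhs_nbhs.
have [C UC] := dj_dominated djU Tt.
have V0t := V0_gt0 Tt.
have nV0 : \forall s \near t, V zero t / 2 < V zero s.
  have [dV _] := jetV (a := zero) ltac:(by rewrite mdeg0) Tt.
  have cV : V zero s @[s --> t] --> V zero t := differentiable_continuous dV.
  have V2 : V zero t / 2 < V zero t by rewrite ltr_pdivrMr// ltr_pMr// ltr1n.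
  exact: (cvgr_gt _ cV _ V2).
have nV : \forall s \near t, forall b, `|V b s| <= C * \int[mu]_(x in X) Phi x.
  apply: filterS2 nT UC => s Ts UC b.
  have iCP : mu.-integrable X (EFin \o (fun x => C * Phi x)).
    have := integrableZl mX C iPhi.
    by apply: eq_integrable => // x' _ /=; rewrite EFinM.
  have iU : mu.-integrable X (EFin \o U b s) by exact: (dj_integrable openTheta mX djU).
  rewrite (le_trans (le_normr_Rintegral mX iU))// -RintegralZl//.
  apply: le_Rintegral => //; last by move=> x Xx; exact: UC.
  by have := integrable_abse iU; apply: eq_integrable.
set M := \int[mu]_(x in X) Phi x in nV.
have [n] := ubnP (mdeg a); elim: n a => // n IH a; rewrite ltnS => an.
have /choice[K HK] (b : midx d p) : exists K : R, mle b a && (b != a) ->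
    \forall s \near t, forall x, X x -> `|W b s x| <= K * Phi x.
  have [bl|_] := boolP (mle b a && (b != a)); last by exists 0.
  have /andP[ba nba] := bl.
  by have [|K HK] := IH b; [exact: leq_trans (mdeg_lt ba nba) an|exists K].
exists ((C + \sum_(b | mle b a && (b != a)) (mbinom a b)%:R * (K b * (C * M))) /
   (V zero t / 2)).
have nK : \forall s \near t, forall b, mle b a && (b != a) ->
    forall x, X x -> `|W b s x| <= K b * Phi x.
  apply: (@filter_forall _ (midx d p) (fun b s => mle b a && (b != a) ->
    forall x, X x -> `|W b s x| <= K b * Phi x) (nbhs t) (nbhs_filter t)) => b.
  have [bl|_] := boolP (mle b a && (b != a)); last by apply: nearW => s.
  by apply: filterS (HK b bl) => s + _.
have nn : \forall s \near t, [/\ Theta s, V zero t / 2 < V zero s,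
   forall a x, X x -> `|U a s x| <= C * Phi x,
   forall b, `|V b s| <= C * M & forall b, mle b a && (b != a) ->
    forall x, X x -> `|W b s x| <= K b * Phi x].
  by apply: filterS (filterI nT (filterI nV0 (filterI UC (filterI nV nK)))) => s
    [? [? [? [? ?]]]]; split.
apply: filterS nn => s [Ts Vs Us Vbs Ks] x Xx.
have V2 : 0 < V zero t / 2 by rewrite divr_gt0.
rewrite WE// normrM normfV (gtr0_norm (V0_gt0 Ts)).
rewrite [leRHS]mulrAC; apply: ler_pM => //.
- by rewrite invr_ge0 ltW ?V0_gt0.
- rewrite (le_trans (ler_normB _ _))// mulrDl lerD ?Us//.
  rewrite (le_trans (ler_norm_sum _ _ _))// mulr_suml; apply: ler_sum => b bl.
  rewrite normrM ger0_norm// normrM.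
  have -> : (mbinom a b)%:R * (K b * (C * M)) * Phi x =
    (mbinom a b)%:R * (K b * Phi x * (C * M)) by ring.
  by rewrite ler_wpM2l// ler_pM//; exact: Ks.
- move: V2 (ltW Vs) (V0_gt0 Ts).
  move: (V zero t / 2) (V zero s) => u v u0 uv v0.
  by rewrite lef_pV2.
Qed.

Let W_jet : dominated_jet Theta X mu Phi W.
Proof.
split => //.
- move=> x Xx; apply: (jet_div openTheta (dj_jet djU Xx) jetV).
    by move=> t Tt; rewrite gt_eqF// V0_gt0.
  by move=> a t Tt; exact: WV.
- move=> t Tt; have mU : measurable_fun X (fun x => U zero t x * (V zero t)^-1).
    apply: measurable_funM; last exact: measurable_cst.
    exact: (dj_measurable openTheta djU).
  by apply: eq_measurable_fun mU => x /set_mem Xx; rewrite -W0E.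
- move=> t Tt; apply: (dominated_all (D := W)) => // a.
  exact: W_dominated.
Qed.

(** The map [Fmap] applied to a vector measure that consists of derivatives of a
    density gives the derivatives of the density updated by Bayes' rule. *)
Lemma filter_stage_step :
  filter_stage Theta X mu Phi (fun a t x => fder X mu pt qt t y a x (L t))
    (fun t => Fmap X mu pt qt t y (L t)).
Proof.
split; [exact: muX|exact: W_jet|exact: W_ge0|exact: W_mass|].
move=> a t B Tt mB BX; apply: density_chargeE => //.
exact: (dj_integrable openTheta mX W_jet).
Qed.

End FilterStep.

(** * The filter recursion *)

Section FilterRecursion.
Variables (R : realType) (d dx dy p : nat) (Theta : set 'rV[R]_d).
Hypotheses (openTheta : open Theta) (p_gt0 : (0 < p)%N).
Local Notation state := (borelRn R dx).
Local Notation obs := (borelRn R dy).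
Variables (X : set state) (mX : measurable X) (mu : {measure set state -> \bar R}).
Hypothesis muX : (mu X < +oo)%E.
Variables (pt : 'rV[R]_d -> state -> state -> R) (qt : 'rV[R]_d -> obs -> state -> R).
Variables (ys : nat -> obs) (Phi : nat -> state -> R).
Hypothesis reg : forall n, (0 < n)%N -> regular_kernel p Theta X mu pt qt (ys n) (Phi n).
Variables (lambda : probability state R) (m : nat).
Hypothesis lambdaX : lambda X = 1%E.

Local Notation zero := (midx0 d p).
Local Notation r n t x x' := (rt pt qt t (ys n) x x').
Local Notation rn n t x x' := (rt_iter X mu pt qt t ys m n x x').
Local Notation E0 := (vmeasure_init d p lambda).

Let r_le n t x x' : (0 < n)%N -> Theta t -> X x -> X x' -> r n t x x' <= Phi n x.
Proof.
move=> n0 Tt Xx Xx'; have := rk_dominated (reg n0) zero Tt Xx Xx'.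
by rewrite mpartial_id; apply: le_trans; exact: ler_norm.
Qed.

Let lambda_fin : (lambda X < +oo)%E.
Proof. by rewrite lambdaX ltry. Qed.

(** The initial distribution has density one with respect to itself, and this
    density does not depend on the parameter. *)
Lemma filter_stage_init : filter_stage Theta X lambda (fun=> 1)
  (fun (a : midx d p) _ _ => if a == zero then 1 else 0 : R) (fun=> E0).
Proof.
have iD (a : midx d p) : lambda.-integrable X (EFin \o (fun=> if a == zero then 1 else 0)).
  exact: integrable_cst_fin.
split; [exact: lambda_fin| |by move=> *; rewrite eqxx| |].
- split => //.
  + exact: integrable_cst_fin.
  + by move=> x Xx; exact: jet_cst.
  + move=> t Tt; exists 1; apply: (@nearW _ (nbhs t)) => s a x Xx.
    by rewrite mulr1; case: ifP; rewrite ?normr1 ?normr0.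
- by move=> t Tt; rewrite eqxx Rintegral_cst// mul1r; exact: (congr1 fine lambdaX).
- move=> a t B Tt mB BX; rewrite /vmeasure_init; case: ifP => _.
    by rewrite integral_cst// mul1e.
  by rewrite integral0.
Qed.

Lemma Fmap_iter_start t (L : vmeasure R d dx p) :
  Fmap_iter X mu pt qt t ys m m L = L.
Proof. by case: m => //= k; rewrite ltnn. Qed.

Lemma Fmap_iterS n t (L : vmeasure R d dx p) : (m <= n)%N ->
  Fmap_iter X mu pt qt t ys m n.+1 L =
  Fmap X mu pt qt t (ys n.+1) (Fmap_iter X mu pt qt t ys m n L).
Proof. by move=> /= ->. Qed.

Lemma filter_stage_iter n : (m < n)%N ->
  filter_stage Theta X mu (Phi n) (fun a t x => fder_iter X mu pt qt t ys a m n x E0)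
    (fun t => Fmap_iter X mu pt qt t ys m n E0).
Proof.
have step n' k G D : (m <= n')%N ->
    filter_stage Theta X k G D (fun t => Fmap_iter X mu pt qt t ys m n' E0) ->
    filter_stage Theta X mu (Phi n'.+1)
      (fun a t x => fder_iter X mu pt qt t ys a m n'.+1 x E0)
      (fun t => Fmap_iter X mu pt qt t ys m n'.+1 E0).
  move=> mn st; have := filter_stage_step openTheta p_gt0 mX muX (reg (ltn0Sn n')) st.
  by under [X in filter_stage _ _ _ _ _ X -> _]eq_fun do rewrite -Fmap_iterS//.
elim: n => // n IH; rewrite ltnS leq_eqVlt => /predU1P[<-|mn].
  apply: (step m _ _ _ (leqnn m)).
  have -> : (fun t => Fmap_iter X mu pt qt t ys m m E0) = fun=> E0.
    by apply/funext => t; exact: Fmap_iter_start.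
  exact: filter_stage_init.
exact: (step n _ _ _ (ltnW mn) (IH mn)).
Qed.

(** Joint measurability and the bound by a function of the last state are what
    Tonelli's theorem requires of the iterated kernels. *)
Lemma rt_iter_regular n t : (m < n)%N -> Theta t ->
  measurable_fun (X `*` X) (fun z => rn n t z.1 z.2) /\
  exists2 C : R, 0 <= C & forall x x', X x -> X x' -> 0 <= rn n t x x' <= C * Phi n x.
Proof.
move=> + Tt; elim: n => // n IH.
rewrite ltnS leq_eqVlt => /predU1P[->|mn].
  rewrite /= eqxx; split; first exact: (rk_measurable (reg (ltn0Sn n))).
  exists 1 => // x x' Xx Xx'.
  by rewrite mul1r r_le// (rk_ge0 (reg (ltn0Sn n))).
have [mrn [C C0 rnC]] := IH mn.
rewrite /= ltn_eqF//; have n0 : (0 < n)%N by apply: leq_ltn_trans mn.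
have P0 := rk_bound_ge0 (reg n0).
have iP := rk_bound_integrable (reg n0).
have rS0 := rk_ge0 (reg (ltn0Sn n)).
have mXX : measurable (X `*` X) by exact: measurableX.
pose f (z : state * state) x'' := r n.+1 t z.1 x'' * rn n t x'' z.2.
have f0 z x'' : (X `*` X) z -> X x'' -> 0 <= f z x''.
  move=> [Xz1 Xz2] Xx''; rewrite mulr_ge0// ?rS0//.
  by have /andP[] := rnC _ _ Xx'' Xz2.
have mf : measurable_fun ((X `*` X) `*` X) (fun w => f w.1 w.2).
  apply: measurable_funM.
    apply: (@measurable_comp _ _ _ _ _ _ (X `*` X) (fun z => r n.+1 t z.1 z.2) _
      (fun w : (state * state) * state => (w.1.1, w.2))) => //.
    - by move=> _ [[[u v] w] [/= [? ?] ?] <-].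
    - exact: (rk_measurable (reg (ltn0Sn n))).
    - apply: measurable_funTS; apply: measurable_fun_pair => //.
      exact: measurableT_comp.
  apply: (@measurable_comp _ _ _ _ _ _ (X `*` X) (fun z => rn n t z.1 z.2) _
    (fun w : (state * state) * state => (w.2, w.1.2))) => //.
  - by move=> _ [[[u v] w] [/= [? ?] ?] <-].
  - apply: measurable_funTS; apply: measurable_fun_pair => //.
    exact: measurableT_comp.
split.
  exact: (measurable_Rintegral_on mXX mX muX mf f0).
exists (C * \int[mu]_(x in X) Phi n x).
  by rewrite mulr_ge0//; exact: Rintegral_ge0.
move=> x x' Xx Xx'.
have fle (z : state * state) x'' : (X `*` X) z -> X x'' ->
    f z x'' <= Phi n.+1 z.1 * (C * Phi n x'').
  move=> [Xz1 Xz2] Xx''; have /andP[a0 a1] := rnC _ _ Xx'' Xz2.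
  by apply: ler_pM => //; [exact: rS0|exact: r_le].
have iCP : mu.-integrable X (EFin \o (fun x'' => C * Phi n x'')).
  have := integrableZl mX C iP.
  by apply: eq_integrable => // u _ /=; rewrite EFinM.
have xx' : (X `*` X) (x, x') by split.
have := Rintegral_section_le (G1 := fun z => Phi n.+1 z.1) mXX mX mf f0 iCP fle xx'.
by rewrite /= RintegralZl// mulrC.
Qed.

(* [N] is the unnormalized filter density; by [NS] it satisfies the same recursion
   as the filter, without the normalization *)
Let N n t x := \int[lambda]_(x' in X) rn n t x x'.

Let N_denominator n t : (m < n)%N -> Theta t ->
  \int[lambda]_(x' in X) \int[mu]_(x'' in X) rn n t x'' x' = \int[mu]_(x in X) N n t x.
Proof.
move=> mn Tt; have [mrn [C C0 rnC]] := rt_iter_regular mn Tt.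
have n0 : (0 < n)%N by apply: leq_ltn_trans mn.
apply/esym/(Rintegral_swap (f := fun x x' => rn n t x x') mX mX muX lambda_fin mrn
  (G1 := Phi n) (G2 := fun=> C)).
- by move=> x x' Xx Xx'; rewrite mulrC rnC.
- exact: (rk_bound_integrable (reg n0)).
- exact: integrable_cst_fin.
Qed.

Let NS n t x : (m < n)%N -> Theta t -> X x ->
  N n.+1 t x = \int[mu]_(x'' in X) (r n.+1 t x x'' * N n t x'').
Proof.
move=> mn Tt Xx; have [mrn [C C0 rnC]] := rt_iter_regular mn Tt.
have n0 : (0 < n)%N by apply: leq_ltn_trans mn.
have iP := rk_bound_integrable (reg n0).
have mrx : measurable_fun X (fun x'' => r n.+1 t x x'').
  exact: (measurable_section (f := fun x x' => r n.+1 t x x') mX mX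
    (rk_measurable (reg (ltn0Sn n)) Tt) Xx).
rewrite /N /= ltn_eqF//.
rewrite -(Rintegral_swap (f := fun x'' x' => r n.+1 t x x'' * rn n t x'' x')
  mX mX muX lambda_fin _ (G1 := fun x'' => Phi n.+1 x * Phi n x'') (G2 := fun=> C)).
- apply: eq_Rintegral => x'' /set_mem Xx''; rewrite RintegralZl//.
  apply: (bounded_integrable mX (M := C * Phi n x'') lambda_fin).
    exact: (measurable_section (f := fun x x' => rn n t x x') mX mX mrn Xx'').
  by move=> x' Xx'; have /andP[a0 a1] := rnC _ _ Xx'' Xx'; rewrite ger0_norm.
- apply: measurable_funM; last exact: mrn.
  apply: (@measurable_comp _ _ _ _ _ _ X (fun x'' => r n.+1 t x x'') _ fst) => //.
  + by move=> _ [[u v] [/= ? ?] <-].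
  + exact: measurable_funTS.
- move=> x'' x' Xx'' Xx'; have /andP[a0 a1] := rnC _ _ Xx'' Xx'.
  rewrite mulr_ge0//=; last exact: (rk_ge0 (reg (ltn0Sn n))).
  rewrite -mulrA [Phi n x'' * C]mulrC ler_pM//; last exact: r_le.
  exact: (rk_ge0 (reg (ltn0Sn n))).
- have := integrableZl mX (Phi n.+1 x) iP.
  by apply: eq_integrable => // u _ /=; rewrite EFinM.
- exact: integrable_cst_fin.
Qed.

Let iN n t : (m < n)%N -> Theta t -> mu.-integrable X (EFin \o N n t).
Proof.
move=> mn Tt; have [mrn [C C0 rnC]] := rt_iter_regular mn Tt.
have n0 : (0 < n)%N by apply: leq_ltn_trans mn.
apply: (integrable_Rintegral_section (f := fun x x' => rn n t x x') mX mX lambda_fin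
  mrn _ (rk_bound_integrable (reg n0)) (integrable_cst_fin mX C lambda_fin)).
- by move=> x x' Xx Xx'; have /andP[] := rnC x x' Xx Xx'.
- by move=> x x' Xx Xx'; rewrite mulrC; have /andP[] := rnC x x' Xx Xx'.
Qed.

(** Normalizing at each step or once at the end gives the same density, because the
    normalizing constant [Z] of the previous step cancels in the quotient. *)
Lemma filter_densityE n t x : (m < n)%N -> Theta t -> X x ->
  filter_density X mu pt qt t ys m n lambda x =
  fder_iter X mu pt qt t ys zero m n x E0.
Proof.
have fdE n' t' x' : (m < n')%N -> Theta t' ->
    filter_density X mu pt qt t' ys m n' lambda x' =
    N n' t' x' / \int[mu]_(x in X) N n' t' x.
  by move=> mn' Tt'; rewrite /filter_density N_denominator.
elim: n x => // n IH x mn Tt Xx; rewrite fdE//.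
have n1 : (0 < n.+1)%N by [].
move: (mn); rewrite ltnS leq_eqVlt => /predU1P[E|mn'].
  rewrite /fder_iter /= -E Fmap_iter_start.
  rewrite (filter_step_density0 openTheta mX (reg (ltn0Sn m)) filter_stage_init Tt Xx).
  rewrite eqxx; have rE x' : N m.+1 t x' = \int[lambda]_(x in X) (r m.+1 t x' x * 1).
    by rewrite /N /= eqxx; apply: eq_Rintegral => u _; rewrite mulr1.
  by rewrite rE; congr (_ / _); apply: eq_Rintegral => u _; rewrite rE.
have st := filter_stage_iter mn'.
rewrite /fder_iter /= (filter_step_density0 openTheta mX (reg n1) st Tt Xx).
set Z := \int[mu]_(x in X) N n t x.
have DE u : X u -> fder_iter X mu pt qt t ys zero m n u E0 = N n t u / Z.
  by move=> Xu; rewrite -fdE// IH.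
(* otherwise the previous density would vanish, contrary to its having mass one *)
have Z0 : Z != 0.
  apply/eqP => Z0; have := fs_mass st Tt.
  under eq_Rintegral => u /set_mem Xu do rewrite DE// Z0 invr0 mulr0.
  by rewrite Rintegral_cst// mul0r => /esym/eqP; rewrite oner_eq0.
have rE u : X u -> \int[mu]_(v in X) (r n.+1 t u v *
    fder_iter X mu pt qt t ys zero m n v E0) = N n.+1 t u / Z.
  move=> Xu; rewrite NS// -RintegralZr//.
    by apply: eq_Rintegral => v /set_mem Xv; rewrite DE// mulrA.
  apply: (bounded_mul_integrable mX (M := Phi n.+1 u) _ _ (iN mn' Tt)).
    exact: (measurable_section (f := fun x x' => r n.+1 t x x') mX mX
      (rk_measurable (reg n1) Tt) Xu).
  by move=> v Xv; rewrite ger0_norm ?r_le// (rk_ge0 (reg n1)).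
rewrite rE//; transitivity (N n.+1 t x / Z / ((\int[mu]_(u in X) N n.+1 t u) / Z)).
  by rewrite invfM invrK mulrACA mulVf// mulr1.
congr (_ / _); rewrite -RintegralZr//; last exact: iN.
by apply: eq_Rintegral => u /set_mem Xu; rewrite rE.
Qed.

End FilterRecursion.

(** * From the conditions on the model to the theorem *)

Section RegularKernel.
Variables (R : realType) (d dx dy p : nat) (Theta : set 'rV[R]_d).
Hypothesis openTheta : open Theta.
Local Notation state := (borelRn R dx).
Local Notation obs := (borelRn R dy).
Variables (X : set state) (mX : measurable X) (mu : {measure set state -> \bar R}).
Variables (pt : 'rV[R]_d -> state -> state -> R) (qt : 'rV[R]_d -> obs -> state -> R).
Variables (y : obs) (eps psi : R) (phi : state -> R).
Hypothesis pt_ge0 : forall t x' x, Theta t -> X x' -> X x -> 0 <= pt t x' x.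
Hypothesis qt_ge0 : forall t x, Theta t -> X x -> 0 <= qt t y x.
Hypothesis mpt : forall t, Theta t ->
  measurable_fun (X `*` X) (fun z : state * state => pt t z.1 z.2).
Hypothesis mqt : forall t, Theta t -> measurable_fun X (fun x => qt t y x).
Hypothesis diff_pt : forall x' x, X x' -> X x ->
  ntimes_differentiable p Theta (fun t => pt t x' x).
Hypothesis diff_qt : forall x, X x -> ntimes_differentiable p Theta (fun t => qt t y x).
Hypothesis eps_gt0 : 0 < eps.
Hypothesis minorant : forall t, Theta t -> exists mu_ty : {measure set state -> \bar R},
  (0 < mu_ty X < +oo)%E /\ forall (x : state) (B : set state), X x -> measurable B -> B `<=` X ->
    (eps%:E * mu_ty B <= \int[mu]_(x' in B) (rt pt qt t y x' x)%:E)%E /\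
    (\int[mu]_(x' in B) (rt pt qt t y x' x)%:E <= eps^-1%:E * mu_ty B)%E.
Hypothesis psi_ge1 : 1 <= psi.
Hypothesis derivative_bound : forall t x x' (a : midx d p), Theta t -> X x -> X x' ->
  a != midx0 d p ->
  `|mpartial a (fun s => rt pt qt s y x' x) t| <= psi ^+ mdeg a * rt pt qt t y x' x.
Hypothesis phi_ge1 : forall x, X x -> 1 <= phi x.
Hypothesis mphi : measurable_fun X phi.
Hypothesis rt_le_phi : forall t x x', Theta t -> X x -> X x' -> rt pt qt t y x' x <= phi x'.
Hypothesis phi_fin : (\int[mu]_(x in X) (phi x)%:E < +oo)%E.

Let phi_ge0 x : X x -> 0 <= phi x.
Proof. by move=> Xx; apply: le_trans (phi_ge1 Xx). Qed.

(** An integrable function that is at least one forces the measure of the space to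
    be finite. *)
Lemma state_space_fin : (mu X < +oo)%E.
Proof.
apply: le_lt_trans phi_fin; rewrite -[leLHS]mul1e -integral_cst//.
by apply: ge0_le_integral => //; exact/measurable_EFinP.
Qed.

(** The factor [psi ^+ p] is a common bound of the [psi ^+ mdeg a], as [psi] is at
    least one. *)
Lemma regular_kernel_of_conditions :
  regular_kernel p Theta X mu pt qt y (fun x => psi ^+ p * phi x).
Proof.
have r0 t x x' : Theta t -> X x -> X x' -> 0 <= rt pt qt t y x x'.
  by move=> Tt Xx Xx'; rewrite mulr_ge0// ?qt_ge0// pt_ge0.
have psi0 : 0 <= psi by exact: le_trans psi_ge1.
split => //.
- move=> x x' Xx Xx'.
  have [] := jet_represents openTheta (f := fun t => rt pt qt t y x x')
    (jet_mul (jet_mpartial openTheta (diff_qt Xx)) (jet_mpartial openTheta (diff_pt Xx Xx'))).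
    by move=> t Tt; rewrite sum_mle0 mbinomn mul1r msubn !mpartial_id.
  by [].
- move=> t Tt; apply: measurable_funM; last exact: mpt.
  apply: (@measurable_comp _ _ _ _ _ _ X (fun x => qt t y x) _ fst) => //.
  + by move=> _ [[u v] [/= ? ?] <-].
  + exact: mqt.
  + exact: measurable_funTS.
- move=> a t x x' Tt Xx Xx'; have [->|a0] := eqVneq a (midx0 d p).
    rewrite mpartial_id ger0_norm ?r0// (le_trans (rt_le_phi Tt Xx' Xx))//.
    by rewrite ler_peMl ?phi_ge0// exprn_ege1.
  rewrite (le_trans (derivative_bound Tt Xx' Xx a0))// ler_pM ?exprn_ge0 ?r0//.
    by rewrite ler_weXn2l// mdeg_le.
  exact: rt_le_phi.
- by move=> x Xx; rewrite mulr_ge0 ?exprn_ge0 ?phi_ge0.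
- have iphi : mu.-integrable X (EFin \o phi).
    apply/integrableP; split; first exact/measurable_EFinP.
    under eq_integral => x /set_mem Xx do rewrite /= ger0_norm ?phi_ge0//.
    exact: phi_fin.
  have := integrableZl mX (psi ^+ p) iphi.
  by apply: eq_integrable => // x _ /=; rewrite EFinM.
- move=> t Tt; have [mt [/andP[mt0 mtoo] H]] := minorant Tt.
  have mtfin : mt X \is a fin_num by rewrite ge0_fin_numE ?ltW.
  exists (eps * fine (mt X)).
    by rewrite mulr_gt0// fine_gt0// mt0.
  move=> x' Xx'; have [H1 H2] := H x' X Xx' mX (@subset_refl _ X).
  rewrite -lee_fin EFinM fineK// fineK//.
  rewrite ge0_fin_numE; last by apply: integral_ge0 => x Xx; rewrite lee_fin r0.
  by apply: le_lt_trans H2 _; rewrite -(fineK mtfin) -EFinM ltry.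
Qed.

End RegularKernel.

Theorem theorem2p1 (R : realType) (d dx dy p : nat)
  (d_ge1 : (1 <= d)%N) (dx_ge1 : (1 <= dx)%N) (dy_ge1 : (1 <= dy)%N)
  (p_ge1 : (1 <= p)%N)
  (Theta : set 'rV[R]_d)
  (openTheta : open Theta) (boundedTheta : bounded_set Theta)
  (X : set (borelRn R dx)) (mX : measurable X)
  (Y : set (borelRn R dy)) (mY : measurable Y)
  (mu : {measure set (borelRn R dx) -> \bar R})
  (nu : {measure set (borelRn R dy) -> \bar R})
  (pt : 'rV[R]_d -> borelRn R dx -> borelRn R dx -> R)
  (qt : 'rV[R]_d -> borelRn R dy -> borelRn R dx -> R)
  (pt_ge0 : forall theta x' x, Theta theta -> X x' -> X x -> 0 <= pt theta x' x)
  (qt_ge0 : forall theta y x, Theta theta -> Y y -> X x -> 0 <= qt theta y x)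
  (mpt : forall theta, Theta theta ->
     measurable_fun (X `*` X) (fun z : borelRn R dx * borelRn R dx => pt theta z.1 z.2))
  (mqt_y : forall theta x, Theta theta -> X x ->
     measurable_fun Y (fun y => qt theta y x))
  (mqt_x : forall theta y, Theta theta -> Y y ->
     measurable_fun X (fun x => qt theta y x))
  (int_pt : forall theta x, Theta theta -> X x ->
     (\int[mu]_(x' in X) (pt theta x' x)%:E = 1)%E)
  (int_qt : forall theta x, Theta theta -> X x ->
     (\int[nu]_(y in Y) (qt theta y x)%:E = 1)%E)
  (diff_pt : forall x' x, X x' -> X x ->
     ntimes_differentiable p Theta (fun theta => pt theta x' x))
  (diff_qt : forall y x, Y y -> X x ->
     ntimes_differentiable p Theta (fun theta => qt theta y x))
  (cond1 : exists2 eps : R, 0 < eps < 1 &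
     forall theta y, Theta theta -> Y y ->
     exists mu_ty : {measure set (borelRn R dx) -> \bar R},
       (0 < mu_ty X < +oo)%E /\
       forall (x : borelRn R dx) (B : set (borelRn R dx)), X x -> measurable B -> B `<=` X ->
         (eps%:E * mu_ty B <= \int[mu]_(x' in B) (rt pt qt theta y x' x)%:E)%E /\
         (\int[mu]_(x' in B) (rt pt qt theta y x' x)%:E <= eps^-1%:E * mu_ty B)%E)
  (cond2 : exists2 psi : borelRn R dy -> R, (forall y, Y y -> 1 <= psi y) &
     forall theta x x' y (a : midx d p), Theta theta -> X x -> X x' -> Y y ->
       a != midx0 d p ->
       `|mpartial a (fun t => rt pt qt t y x' x) theta|
         <= psi y ^+ mdeg a * rt pt qt theta y x' x)
  (cond3 : exists phi : borelRn R dy -> borelRn R dx -> R,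
     [/\ forall y x, Y y -> X x -> 1 <= phi y x,
         forall y, Y y -> measurable_fun X (phi y),
         forall theta x x' y, Theta theta -> X x -> X x' -> Y y ->
           rt pt qt theta y x' x <= phi y x' &
         forall y, Y y -> (\int[mu]_(x'' in X) (phi y x'')%:E < +oo)%E]) :
  forall (lambda : probability (borelRn R dx) R) (ys : nat -> borelRn R dy)
    (m n : nat),
    lambda X = 1%E -> (forall k, (1 <= k)%N -> Y (ys k)) -> (m < n)%N ->
  [/\ forall x, X x ->
        ntimes_differentiable p Theta
          (fun theta => filter_density X mu pt qt theta ys m n lambda x),
      forall B : set (borelRn R dx), measurable B -> B `<=` X ->
        ntimes_differentiable p Theta
          (fun theta => filter_prob X mu pt qt theta ys m n lambda B),
      forall theta (a : midx d p) x, Theta theta -> X x ->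
        mpartial a
          (fun t => filter_density X mu pt qt t ys m n lambda x) theta
        = fder_iter X mu pt qt theta ys a m n x (vmeasure_init d p lambda) &
      forall theta (a : midx d p) (B : set (borelRn R dx)), Theta theta ->
        measurable B -> B `<=` X ->
        (mpartial a
          (fun t => filter_prob X mu pt qt t ys m n lambda B) theta)%:E
        = Fmap_iter X mu pt qt theta ys m n (vmeasure_init d p lambda) a B].
Proof.
move=> lambda ys m n lambdaX Yys mn.
have [eps /andP[eps0 _] minor] := cond1.
have [psi psi1 psiH] := cond2.
have [phi [phi1 mphi rphi phifin]] := cond3.
have muX : (mu X < +oo)%E.
  (* the finiteness of [mu] on [X] needs some observation to exist *)
  have Y1 : Y (ys 1%N) by exact: Yys.
  exact: (state_space_fin mX (fun x Xx => phi1 _ x Y1 Xx) (mphi _ Y1) (phifin _ Y1)).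
pose Phi k x := psi (ys k) ^+ p * phi (ys k) x.
have reg k : (0 < k)%N -> regular_kernel p Theta X mu pt qt (ys k) (Phi k).
  move=> /Yys Yk; apply: (@regular_kernel_of_conditions _ _ _ _ _ _ openTheta _ mX _ _ _ _ eps).
  - exact: pt_ge0.
  - by move=> t x Tt Xx; exact: qt_ge0.
  - exact: mpt.
  - by move=> t Tt; exact: mqt_x.
  - exact: diff_pt.
  - by move=> x Xx; exact: diff_qt.
  - exact: eps0.
  - by move=> t Tt; exact: minor.
  - exact: psi1.
  - by move=> t x x' a Tt Xx Xx'; exact: psiH.
  - by move=> x Xx; exact: phi1.
  - exact: mphi.
  - by move=> t x x' Tt Xx Xx'; exact: rphi.
  - exact: phifin.
have stage := filter_stage_iter openTheta p_ge1 mX muX reg lambdaX mn.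
have dj := fs_jet stage.
have densityE t x : Theta t -> X x -> filter_density X mu pt qt t ys m n lambda x =
    fder_iter X mu pt qt t ys (midx0 d p) m n x (vmeasure_init d p lambda).
  exact: (filter_densityE openTheta p_ge1 mX muX reg lambdaX mn).
have density x : X x -> _ := fun Xx =>
  jet_represents openTheta (dj_jet dj Xx) (fun t Tt => densityE t x Tt Xx).
have prob B (mB : measurable B) (BX : B `<=` X) :=
  jet_represents openTheta (f := fun t => filter_prob X mu pt qt t ys m n lambda B)
    (jet_Rintegral openTheta mX dj mB BX)
    (fun t Tt => eq_Rintegral mu (fun x xB => densityE t x Tt (BX x (set_mem xB)))).
split.
- by move=> x Xx; have [] := density x Xx.
- by move=> B mB BX; have [] := prob B mB BX.
- by move=> t a x Tt Xx; have [_ ->] := density x Xx.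
- move=> t a B Tt mB BX; have [_ ->//] := prob B mB BX.
  rewrite (fs_charge stage a Tt mB BX) EFin_Rintegral//.
  exact: (integrableS mX mB BX (dj_integrable openTheta mX dj a Tt)).
Qed.
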